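(* For every $k\in\mathbb{N}=\{1,2,3,\dots\}$, \[ \Phi_8(k)=F_8(k):=\max_{1\le j\le k}\frac{j}{j+\lceil 2\sqrt{j}\,\rceil+1},\qquad \Phi_4(k)\le F_4(k):=\max_{1\le j\le k}\frac{j}{j+\frac{\lceil 2\sqrt{2j-1}\,\rceil}{2}} . \] Moreover, $\Phi_4(k)=F_4(k)$ for every $k\in\mathcal{S}$, and $\Phi_4(k)<F_4(k)$ for every $k\in\mathcal{U}$, where \[ \mathcal{S}:=\mathbb{N}\cap\bigcup_{n=1}^{\infty}\Big(\Big[s_0(n)-\tfrac n2,\ s_0(n)+\tfrac{n-1}{2}\Big]\cup\Big[s_2(n)-\tfrac n2,\ s_2(n)+\tfrac n2\Big]\Big)=\{1,2,4,5,7,8,9,12,13,14,17,18,19,23,24,25,26,30,\dots\}, \] \[ \mathcal{U}:=\mathbb{N}_{\ge 2}\cap\bigcup_{n=1}^{\infty}\Big(\Big[s_1(n),\ s_1(n)+\tfrac{n-1}{2}\Big]\cup\Big[s_3(n),\ s_3(n)+\tfrac n2\Big]\Big)=\{3,6,10,11,15,16,21,22,28,29,\dots\}, \] with $s_0(n)=(n-1)^2+n^2$, $s_1(n)=n(2n-1)$, $s_2(n)=2n^2$, $s_3(n)=n(2n+1)$.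
   Context: An infinite binary image is a map $I:\mathbb{Z}^2\to\{\text{black},\text{white}\}$; its elements are pixels. For $x,y\in\mathbb{Z}^2$ let $d_4(x,y)=|x_1-y_1|+|x_2-y_2|$ and $d_8(x,y)=\max\{|x_1-y_1|,|x_2-y_2|\}$; for $\alpha\in\{4,8\}$, $x,y$ are $\alpha$-adjacent if $d_\alpha(x,y)=1$. Two pixels are $\alpha$-connected if they are equal or joined by a sequence of pixels each $\alpha$-adjacent to its predecessor; a white $\alpha$-connected component of $I$ is a maximal set of mutually $\alpha$-connected white pixels (connected within the white pixels), and its size is its number of pixels. The white pixel density of $I$ is $\rho(I)=\liminf_{j\to\infty,\ j\text{ odd}} W_j/j^2$, where $W_j$ is the number of white pixels in the $j\times j$ box of pixels centered at the origin. For $\alpha\in\{4,8\}$ and $k\in\mathbb{N}$, $\Phi_\alpha(k)$ is the supremum of $\rho(I)$ over all infinite binary images $I$ all of whose white $\alpha$-connected components have size at most $k$. *)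

(* Defs.v *)
From HB Require Import structures.
From mathcomp Require Import all_boot all_order all_algebra.
From mathcomp Require Import all_classical all_reals all_analysis.

Set Implicit Arguments.
Unset Strict Implicit.
Unset Printing Implicit Defensive.

Import Order.TTheory GRing.Theory Num.Theory.
Import numFieldNormedType.Exports.

Local Open Scope classical_set_scope.
Local Open Scope ring_scope.

Definition pixel : Type := (int * int)%type.

(* [I x = true] means that the pixel [x] is white. *)
Definition binary_image : Type := pixel -> bool.

Definition d4 (x y : pixel) : nat :=
  (`|(x.1 - y.1)%R| + `|(x.2 - y.2)%R|)%N.

Definition d8 (x y : pixel) : nat :=
  maxn `|(x.1 - y.1)%R|%N `|(x.2 - y.2)%R|%N.

(* Below, alpha = 4 or 8 is represented by the distance [d] = [d4] or [d8]. *)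
Definition adjacent (d : pixel -> pixel -> nat) : rel pixel :=
  fun x y => d x y == 1%N.

Definition white_connected (d : pixel -> pixel -> nat) (I : binary_image)
    (x y : pixel) : Prop :=
  exists p : seq pixel,
    [/\ path (adjacent d) x p, last x p = y & all I (x :: p)].

Definition mutually_white_connected (d : pixel -> pixel -> nat)
    (I : binary_image) (C : set pixel) : Prop :=
  forall x y, C x -> C y -> white_connected d I x y.

Definition white_component (d : pixel -> pixel -> nat) (I : binary_image)
    (C : set pixel) : Prop :=
  [/\ C !=set0, mutually_white_connected d I C &
      forall D : set pixel,
        mutually_white_connected d I D -> C `<=` D -> D `<=` C].

Definition white_components_size_le (d : pixel -> pixel -> nat) (k : nat)
    (I : binary_image) : Prop :=
  forall C : set pixel, white_component d I C -> (C #<= `I_k)%card.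

(* For odd j, the pixels of the j x j box centered at the origin are those with
   both coordinates in {- j./2, ..., j./2}. *)
Definition white_count (I : binary_image) (j : nat) : nat :=
  #|[pred p : 'I_j * 'I_j |
      I (Posz p.1 - Posz j./2, Posz p.2 - Posz j./2)]|.

(* The odd j are enumerated as j = 2 m + 1. *)
Definition density (R : realType) (I : binary_image) : R :=
  limn_inf (fun m : nat =>
    (white_count I m.*2.+1)%:R / (m.*2.+1)%:R ^+ 2 : R).

Definition Phi (R : realType) (d : pixel -> pixel -> nat) (k : nat) : R :=
  sup [set density R I | I in [set I | white_components_size_le d k I]].

(* All the terms are positive, so for k >= 1 the initial value 0 does not
   affect the maxima. *)
Definition F8 (R : realType) (k : nat) : R :=
  \big[Num.max/0]_(1 <= j < k.+1)
    (j%:R / (j%:R + (Num.ceil (2 * Num.sqrt (j%:R : R)))%:~R + 1)).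

Definition F4 (R : realType) (k : nat) : R :=
  \big[Num.max/0]_(1 <= j < k.+1)
    (j%:R / (j%:R + (Num.ceil (2 * Num.sqrt (2 * j%:R - 1 : R)))%:~R / 2)).

Definition s0 (n : nat) : rat := (n%:R - 1) ^+ 2 + n%:R ^+ 2.
Definition s1 (n : nat) : rat := n%:R * (2 * n%:R - 1).
Definition s2 (n : nat) : rat := 2 * n%:R ^+ 2.
Definition s3 (n : nat) : rat := n%:R * (2 * n%:R + 1).

Definition calS : set nat :=
  [set k : nat | (1 <= k)%N /\
    exists2 n : nat, (1 <= n)%N &
      s0 n - n%:R / 2 <= k%:R <= s0 n + (n%:R - 1) / 2 \/
      s2 n - n%:R / 2 <= k%:R <= s2 n + n%:R / 2].

Definition calU : set nat :=
  [set k : nat | (2 <= k)%N /\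
    exists2 n : nat, (1 <= n)%N &
      s1 n <= k%:R <= s1 n + (n%:R - 1) / 2 \/
      s3 n <= k%:R <= s3 n + n%:R / 2].

(* Main.v *)
Require Import Defs.
From mathcomp Require Import all_boot all_order all_algebra.
From mathcomp Require Import all_classical all_reals all_analysis.
From mathcomp Require Import finmap zify ring lra.

Import Order.TTheory GRing.Theory Num.Theory.

Local Open Scope ring_scope.

(** A window is a 2 x 2 block of pixels.

    Upper bound for 8-connectivity: for distinct components C the sets of windows
    meeting C are disjoint, and a component with j pixels in r rows and c columns
    meets at least j + r + c + 1 windows, where r c >= j.

    Upper bound for 4-connectivity: split each window into its two diagonal pairs
    of pixels. A window offers at most two (component, touched pair) incidences,
    and a component with j pixels on p diagonals and q antidiagonals touches at
    least 2 j + p + q pairs. By connectedness the occupied diagonals are consecutive,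
    so C lies in a p x q box of the checkerboard lattice and 2 j <= p q + 1.

    Lower bounds: periodic images for which the colour of a pixel depends on a linear
    form modulo D (for 4-connectivity, together with the parity of the pixel), each
    component being the set of white residues in a block of consecutive values.

    Strictness: for k in U only components of size c (c + 1) / 2 could attain F_4,
    and only when they fill a c x (c + 1) box in diagonal coordinates and every
    window contains two white pixels. Looking at the side of such a box between
    its two flat corners shows that this is locally impossible, so a positive
    proportion of the area is wasted. *)

(** * Density and boxes *)

Lemma bounded_density_seq (R : realType) (I : binary_image) :
  bounded_fun (fun m : nat =>
    (white_count I m.*2.+1)%:R / (m.*2.+1)%:R ^+ 2 : R).
Proof.
exists 1; split; first exact: num_real.
move=> M M1 m _ /=; rewrite ger0_norm; last by rewrite divr_ge0 ?exprn_ge0.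
apply: le_trans (ltW M1); rewrite ler_pdivrMr ?exprn_gt0// mul1r -natrX ler_nat.
rewrite /white_count; apply: leq_trans (max_card _) _.
by rewrite card_prod card_ord.
Qed.

(** Enlarging the box by a fixed margin [K] costs an error linear in its side, which vanishes after
    division by the area. The term [y] stands for waste proportional to the area, as produced in the
    strict case. *)
Lemma density_le (R : realType) (I : binary_image) (K : nat) (x y : R) :
  0 <= x ->
  (forall m, (white_count I m.*2.+1)%:R + y * (m.*2.+1)%:R ^+ 2 <=
     x * (m.*2.+1 + K)%:R ^+ 2) ->
  density R I <= x - y.
Proof.
move=> x0 H; rewrite /density limn_infE; last exact: bounded_density_seq.
have [ub lb] : has_ubound (range (fun m : nat =>
    (white_count I m.*2.+1)%:R / (m.*2.+1)%:R ^+ 2 : R)) /\ has_lbound (range (fun m : nat =>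
    (white_count I m.*2.+1)%:R / (m.*2.+1)%:R ^+ 2 : R)).
  by split; [apply/bounded_fun_has_ubound|apply/bounded_fun_has_lbound]; apply: bounded_density_seq.
apply: ge_sup; first by exists (infs (fun m : nat =>
    (white_count I m.*2.+1)%:R / (m.*2.+1)%:R ^+ 2 : R) 0); exists 0.
move=> _ [n _ <-]; apply/ler_addgt0Pr => e e0.
(* For a side [t >= 1] the error [x * (2 * K * t + K ^ 2)] is at most [c * t], hence at most
   [e * t ^ 2] once [t >= N]. *)
pose c : R := x * (2 * K%:R + K%:R ^+ 2).
have c0 : 0 <= c by rewrite mulr_ge0// addr_ge0 ?mulr_ge0 ?exprn_ge0.
have [N cN] : exists N : nat, c <= e * N%:R.
  exists (Num.bound (c / e)).
  rewrite mulrC -ler_pdivrMr//; apply/ltW/archi_boundP.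
  by rewrite divr_ge0// ltW.
pose m := maxn n N.
apply: (@le_trans _ _ ((white_count I m.*2.+1)%:R / (m.*2.+1)%:R ^+ 2)).
  apply: ge_inf; first exact: has_lbound_sdrop.
  by exists m => //=; rewrite leq_maxl.
have t0 : 0 < (m.*2.+1)%:R :> R by rewrite ltr0n.
have tN : N%:R <= (m.*2.+1)%:R :> R.
  by rewrite ler_nat /m; lia.
have t1 : 1 <= (m.*2.+1)%:R :> R by rewrite ler1n.
rewrite ler_pdivrMr ?exprn_gt0//.
have := H m; rewrite natrD.
set t : R := _%:R in t0 tN t1 *; set W : R := _%:R; set k : R := K%:R in c c0 cN *.
move=> HW.
have h1 : c * t <= e * t ^+ 2.
  rewrite expr2 mulrA ler_pM2r//; apply: le_trans cN _.
  by rewrite ler_pM2l.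
have h2 : x * k ^+2 <= x * k ^+2 * t.
  by rewrite ler_peMr// mulr_ge0// exprn_ge0.
rewrite /c in h1; nra.
Qed.

Lemma density_ge (R : realType) (I : binary_image) (B : nat) (x : R) :
  0 <= x ->
  (forall m, x * (m.*2.+1)%:R ^+ 2 <= (white_count I (m + B).*2.+1)%:R) ->
  x <= density R I.
Proof.
move=> x0 H; rewrite /density limn_infE; last exact: bounded_density_seq.
have bd := bounded_density_seq R I.
apply/ler_addgt0Pr => e e0; rewrite -lerBlDr.
pose c : R := x * (4 * B%:R).
have c0 : 0 <= c by rewrite !mulr_ge0.
have [N cN] : exists N : nat, c <= e * N%:R.
  exists (Num.bound (c / e)).
  rewrite mulrC -ler_pdivrMr//; apply/ltW/archi_boundP.
  by rewrite divr_ge0// ltW.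
(* From [B] on, [m - B] is a genuine subtraction; from [N] on, the linear boundary loss is at most
   [e * t ^ 2]. *)
pose n := maxn B N.
apply: (@le_trans _ _ (infs (fun m : nat =>
    (white_count I m.*2.+1)%:R / (m.*2.+1)%:R ^+ 2 : R) n)); last first.
  by apply: ub_le_sup; [exact: bounded_fun_has_ubound_infs|exists n].
apply: lb_le_inf; first by eexists; exists n => /=.
move=> _ [m /= nm <-].
have := H (m - B)%N; rewrite subnK; last by apply: leq_trans nm; rewrite leq_maxl.
have t0 : 0 < (m.*2.+1)%:R :> R by rewrite ltr0n.
have tN : N%:R <= (m.*2.+1)%:R :> R.
  by rewrite ler_nat; lia.
have -> : ((m - B).*2.+1)%:R = (m.*2.+1)%:R - 2 * B%:R :> R.
  rewrite -natrM -natrB; last by lia.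
  by congr _%:R; lia.
rewrite ler_pdivlMr ?exprn_gt0//.
set t : R := (m.*2.+1)%:R in t0 tN *; set W : R := _%:R; set k : R := B%:R in c c0 cN *.
move=> HW.
have h1 : c * t <= e * t ^+ 2.
  rewrite expr2 mulrA ler_pM2r//; apply: le_trans cN _.
  by rewrite ler_pM2l.
have h2 : 0 <= x * k ^+ 2 by rewrite mulr_ge0// exprn_ge0.
rewrite /c in h1; nra.
Qed.


Definition centered_range (m : nat) : seq int := [seq Posz i - Posz m | i <- index_iota 0 m.*2.+1].

Definition box (m : nat) : seq (int * int) :=
  [seq (x, y) | x <- centered_range m, y <- centered_range m].

Lemma mem_centered_range m (x : int) : (x \in centered_range m) = (`|x| <= m)%N.
Proof.
apply/mapP/idP => [[i]|xm]; first by rewrite mem_index_iota => im ->; lia.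
exists `|(x + m)%R|%N; last by lia.
by rewrite mem_index_iota; lia.
Qed.

Lemma uniq_centered_range m : uniq (centered_range m).
Proof. by rewrite map_inj_uniq ?iota_uniq// => i j /addIr[]. Qed.

Lemma mem_box m (z : int * int) : (z \in box m) = (`|z.1| <= m)%N && (`|z.2| <= m)%N.
Proof.
rewrite -!mem_centered_range; case: z => x y /=; apply/allpairsP/andP => [[[a b] /= [ha hb [-> ->]]]//|[]].
by exists (x, y).
Qed.

Lemma uniq_box m : uniq (box m).
Proof. by apply: allpairs_uniq => [||[a b] [c d] _ _ []//]; rewrite ?uniq_centered_range// => -> ->. Qed.

Lemma size_box m : size (box m) = (m.*2.+1 ^ 2)%N.
Proof. by rewrite size_allpairs size_map size_iota subn0. Qed.

Lemma white_countE (I : binary_image) m :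
  white_count I m.*2.+1 = (\sum_(z <- box m) I z)%N.
Proof.
rewrite /box big_allpairs /= /centered_range big_map big_mkord.
under eq_bigr do rewrite big_map big_mkord.
rewrite pair_big /white_count -sum1_card big_mkcond /=; apply: eq_bigr => -[i j] _ /=.
rewrite !inE /= uphalf_double.
by case: (I _).
Qed.

(** * Discrete Brunn-Minkowski estimates *)

Local Open Scope fset_scope.
Local Open Scope ring_scope.

Lemma ceil2sqrt_ex (n : nat) : exists s, (4 * n <= s ^ 2)%N.
Proof. by exists (4 * n)%N; nia. Qed.

(** The ceiling of twice the square root of [n], defined inside [nat] so that the perimeter
    estimates stay integral; [ceil_2sqrtE] makes the link with [Num.ceil]. *)
Definition ceil2sqrt (n : nat) : nat := ex_minn (ceil2sqrt_ex n).

Lemma ceil2sqrt_ge n : (4 * n <= ceil2sqrt n ^ 2)%N.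
Proof. by rewrite /ceil2sqrt; case: ex_minnP. Qed.

Lemma ceil2sqrt_le n s : (4 * n <= s ^ 2)%N -> (ceil2sqrt n <= s)%N.
Proof. by rewrite /ceil2sqrt; case: ex_minnP => m _ /[apply]. Qed.

Lemma ceil2sqrt_lt n s : (s < ceil2sqrt n)%N -> (s ^ 2 < 4 * n)%N.
Proof. by move=> sn; rewrite ltnNge; apply/negP => /ceil2sqrt_le; rewrite leqNgt sn. Qed.

(** Iterating [f] from a point of [A] eventually leaves [A], and the first point outside lies in the
    image of [A] and keeps the label. So every label occurring on [A] contributes at least one new
    point. *)
Lemma card_fsetU_shift (T U : choiceType) (A : {fset T}) (f : T -> T) (l : T -> U) :
  (forall x, l (f x) = l x) ->
  (forall x, x \in A -> exists n, iter n f x \notin A) ->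
  (#|` A| + #|` l @` A| <= #|` A `|` f @` A|)%N.
Proof.
move=> lf leaves.
have -> : A `|` f @` A = A `|` (f @` A `\` A).
  by apply/fsetP => x; rewrite !inE; case: (x \in A).
rewrite cardfsU fsetIDA fsetIC -fsetIDA fsetDv fsetI0 cardfs0 subn0 leq_add2l.
apply: (@leq_trans #|` l @` (f @` A `\` A)|); last exact: leq_imfset_card.
apply: fsubset_leq_card; apply/fsubsetP => _ /imfsetP[x /= xA ->].
have [n nA nmin] := ex_minnP (leaves x xA).
case: n nA nmin => [|n] nA nmin; first by rewrite /= xA in nA.
have -> : l x = l (iter n.+1 f x) by elim: n.+1 => //= m ->; rewrite lf.
apply/in_imfset; rewrite /= in_fsetD nA /=; apply/in_imfset => /=.
by apply: contraT => /nmin; rewrite ltnn.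
Qed.

Lemma fset_int2_bounded (A : {fset int * int}) :
  exists M, forall z, z \in A -> z \in box M.
Proof.
exists (\sum_(z <- A) (`|z.1| + `|z.2|))%N => z zA; rewrite mem_box.
rewrite (big_fsetD1 _ zA) /=; lia.
Qed.

Definition pshift (a b : int) (z : int * int) : int * int := (z.1 + a, z.2 + b).

Lemma iter_shift2 (a b : int) n (z : int * int) :
  iter n (pshift a b) z = (z.1 + a *+ n, z.2 + b *+ n).
Proof.
by elim: n => [|n /= ->]; rewrite /pshift ?mulr0n ?addr0 -?surjective_pairing //= !mulrSr !addrA.
Qed.

Lemma shift2_leaves (A : {fset int * int}) (a b : int) (z : int * int) :
  (a, b) != (0, 0) ->
  exists n, iter n (pshift a b) z \notin A.
Proof.
move=> ab0; have [M AM] := fset_int2_bounded A.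
exists (`|z.1| + `|z.2| + M + 1)%N; apply/negP => /AM.
rewrite iter_shift2 mem_box /= -[a *+ _]mulr_natr -[b *+ _]mulr_natr !natz.
set n := (_ + 1)%N; have nM : (`|z.1| + `|z.2| + M < n)%N by rewrite /n addn1.
move: nM; move: n => n nM; move/eqP: ab0 => ab0.
have {ab0} : a <> 0 \/ b <> 0.
  case: (eqVneq a 0) => [a0|/eqP]; last by left.
  by right => b0; apply: ab0; rewrite a0 b0.
case=> h /andP[h1 h2].
  have : (n <= `|(a * n)%R|)%N by rewrite abszM absz_nat; nia.
  lia.
have : (n <= `|(b * n)%R|)%N by rewrite abszM absz_nat; nia.
lia.
Qed.

Lemma card_fsetU_shift2 (U : choiceType) (A : {fset int * int}) (a b : int)
    (l : int * int -> U) :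
  (a, b) != (0, 0) -> (forall z, l (pshift a b z) = l z) ->
  (#|` A| + #|` l @` A| <=
   #|` A `|` pshift a b @` A|)%N.
Proof.
move=> ab0 lf; apply: card_fsetU_shift => // z _.
exact: shift2_leaves.
Qed.

Lemma card_fsetU_pred (X : {fset int}) : X != fset0 ->
  (#|` X| + 1 <= #|` X `|` (fun x : int => x - 1)%R @` X|)%N.
Proof.
move=> /fset0Pn[x xX].
apply: leq_trans (@card_fsetU_shift _ unit X (fun x : int => x - 1) (fun=> tt) _ _) => //.
  rewrite leq_add2l cardfs_gt0; apply/fset0Pn; exists tt.
  by apply/imfsetP; exists x.
have [M HM] : exists M : nat, forall z, z \in X -> (`|z| <= M)%N.
  by exists (\sum_(z <- X) `|z|)%N => z zX; rewrite (big_fsetD1 _ zX) /= leq_addr.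
move=> y yX; exists (M + `|y| + 1)%N; apply/negP.
have -> n : iter n (fun x : int => x - 1) y = y - n%:Z.
  by elim: n => [|n /= ->] /=; lia.
move=> /HM; lia.
Qed.

Lemma card_fset_proj (A : {fset int * int}) :
  (#|` A| <= #|` fst @` A| * #|` snd @` A|)%N.
Proof.
rewrite -(size_allpairs pair); apply: uniq_leq_size (fset_uniq A) _ => -[x y] zA.
by apply: allpairs_f; apply/imfsetP; exists (x, y).
Qed.

(** The windows meeting [A], each named by its corner with least coordinates. Two successive unit
    shifts produce them, so that the shift estimate can be applied twice. *)
Definition square_hull (A : {fset int * int}) : {fset int * int} :=
  let B := A `|` pshift (-1) 0 @` A in
  B `|` pshift 0 (-1) @` B.

(** The horizontal shift adds one element per row of [A]; the vertical one adds one per column of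
    [B], which has at least one column more than [A]. Rows times columns is at least the size of
    [A], so AM-GM bounds their sum. *)
Lemma card_square_hull (A : {fset int * int}) : A != fset0 ->
  (#|` A| + ceil2sqrt #|` A| + 1 <= #|` square_hull A|)%N.
Proof.
move=> A0; rewrite /square_hull; set B := A `|` _.
have h1 : (#|` A| + #|` snd @` A| <= #|` B|)%N.
  by apply: (@card_fsetU_shift2 _ A (-1) 0 snd) => // z /=; rewrite addr0.
have h2 : (#|` B| + #|` fst @` B| <=
    #|` B `|` pshift 0 (-1) @` B|)%N.
  by apply: (@card_fsetU_shift2 _ B 0 (-1) fst) => // z /=; rewrite addr0.
have h3 : (#|` fst @` A| + 1 <= #|` fst @` B|)%N.
  apply: leq_trans (card_fsetU_pred _ _) _.
    move/fset0Pn: A0 => [z zA]; apply/fset0Pn; exists z.1; exact/in_imfset.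
  apply: fsubset_leq_card; apply/fsubsetP => x; rewrite in_fsetU => /orP[].
    by case/imfsetP => z /= zA ->; apply/in_imfset; rewrite /B /= inE zA.
  case/imfsetP => _ /= /imfsetP[z /= zA ->] ->.
  apply/imfsetP; exists (pshift (-1) 0 z) => //=.
  by rewrite in_fsetU; apply/orP; right; apply/in_imfset.
have h4 := card_fset_proj A.
have : (ceil2sqrt #|` A| <= #|` fst @` A| + #|` snd @` A|)%N.
  by apply: ceil2sqrt_le; apply: leq_trans (nat_AGM2 _ _); rewrite leq_mul2l.
lia.
Qed.

(** The windows [w] whose pair [w], [w + (1, 1)] meets [A]; [antidiag_hull] is the analogue for the
    pair [w + (1, 0)], [w + (0, 1)]. *)
Definition diag_hull (A : {fset int * int}) : {fset int * int} :=
  A `|` pshift (-1) (-1) @` A.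

Definition antidiag_hull (A : {fset int * int}) : {fset int * int} :=
  pshift (-1) 0 @` A `|` pshift 0 (-1) @` A.

Definition usum (z : int * int) : int := z.1 + z.2.
Definition vdiff (z : int * int) : int := z.1 - z.2.

Lemma shift_inj a b : injective (pshift a b).
Proof. by move=> [x y] [x' y'] [/addIr -> /addIr ->]. Qed.

Lemma card_diag_hull A : (#|` A| + #|` vdiff @` A| <= #|` diag_hull A|)%N.
Proof.
by apply: (@card_fsetU_shift2 _ A (-1) (-1) vdiff) => // z; rewrite /vdiff /pshift /=; lia.
Qed.

(** After translating [A] by [(-1, 0)], the hull is the union of a set with its shift by [(1, -1)],
    which preserves [usum]; the translation only subtracts one from the values of [usum]. *)
Lemma card_antidiag_hull A : (#|` A| + #|` usum @` A| <= #|` antidiag_hull A|)%N.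
Proof.
have -> : antidiag_hull A =
    (pshift (-1) 0 @` A) `|` pshift 1 (-1) @` (pshift (-1) 0 @` A).
  rewrite /antidiag_hull; congr (_ `|` _); apply/fsetP => z.
  apply/imfsetP/imfsetP => /= [[t tA ->]|[_ /imfsetP[t /= tA ->] ->]].
    exists (pshift (-1) 0 t); first exact/in_imfset.
    by rewrite /pshift /=; congr (_, _); lia.
  by exists t => //; rewrite /pshift /=; congr (_, _); lia.
apply: leq_trans (@card_fsetU_shift2 _ _ 1 (-1) usum _ _) => //; last first.
  by move=> z; rewrite /usum /pshift /=; lia.
rewrite (card_imfset _ _ (@shift_inj (-1) 0)) leq_add2l.
have inj1 : injective (fun x : int => x - 1) by move=> x y /addIr.
have <- : #|` (fun x : int => x - 1) @` (usum @` A)| = #|` usum @` A|.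
  by rewrite (card_imfset _ _ inj1).
apply: fsubset_leq_card.
apply/fsubsetP => _ /imfsetP[_ /= /imfsetP[z /= zA ->] ->].
apply/imfsetP; exists (pshift (-1) 0 z); first exact/in_imfset.
by rewrite /usum /pshift /=; lia.
Qed.

Lemma fset_int_interval (X : {fset int}) : X != fset0 ->
  (forall a b c, a \in X -> c \in X -> a <= b <= c -> b \in X) ->
  exists x0, forall x, (x \in X) = (x0 <= x < x0 + #|` X|%:Z).
Proof.
move=> /fset0Pn[x xX] convX.
have [M HM] : exists M : nat, forall z, z \in X -> (`|z| <= M)%N.
  by exists (\sum_(z <- X) `|z|)%N => z zX; rewrite (big_fsetD1 _ zX) /= leq_addr.
have exl : exists n : nat, x - n%:Z \notin X.
  by exists (`|x| + M + 1)%N; apply/negP => /HM; lia.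
have exr : exists n : nat, x + n%:Z \notin X.
  by exists (`|x| + M + 1)%N; apply/negP => /HM; lia.
case: (ex_minnP exl) => l lX lmin; case: (ex_minnP exr) => r rX rmin.
have l0 : (0 < l)%N by case: (posnP l) lX => // ->; rewrite subr0 xX.
have r0 : (0 < r)%N by case: (posnP r) rX => // ->; rewrite addr0 xX.
have XE y : (y \in X) = (x - l%:Z + 1 <= y < x - l%:Z + 1 + (l + r - 1)%N%:Z).
  apply/idP/idP => [yX|yb].
    apply/andP; split; [rewrite leNgt|rewrite ltNge]; apply/negP => h.
      by move/negP: lX; apply; apply: (convX y _ x) => //; lia.
    by move/negP: rX; apply; apply: (convX x _ y) => //; lia.
  have lX' : x - (l - 1)%N%:Z \in X by apply: contraT => /lmin; lia.
  have rX' : x + (r - 1)%N%:Z \in X by apply: contraT => /rmin; lia.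
  by apply: (convX _ _ _ lX' rX'); lia.
exists (x - l%:Z + 1) => y; rewrite XE; do !congr (_ && _); congr (_ < _ + Posz _).
have -> : X = [fset x - l%:Z + 1 + Posz i | i in iota 0 (l + r - 1)].
  apply/fsetP => z; rewrite XE; apply/idP/imfsetP => /= [h|[i]].
    by exists `|(z - (x - l%:Z + 1))%R|%N; rewrite ?mem_iota; lia.
  by rewrite mem_iota; lia.
rewrite card_imfset /=; last by move=> i j /addrI[].
by rewrite undup_id ?size_iota// iota_uniq.
Qed.

(** * White components *)

Lemma card_fset_int_le (X : {fset int}) (a : int) (n : nat) :
  (forall x, x \in X -> a <= x < a + n%:Z) -> (#|` X| <= n)%N.
Proof.
move=> HX; have -> : n = size [seq a + Posz i | i <- iota 0 n].
  by rewrite size_map size_iota.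
apply: uniq_leq_size (fset_uniq X) _ => x /HX h.
by apply/mapP; exists `|(x - a)%R|%N; rewrite ?mem_iota; lia.
Qed.

(** [usum] and [vdiff] have the same parity, so only one colour class of the [p] by [q] checkerboard
    is available. The induction removes two consecutive antidiagonals at a time: [vdiff] is
    injective on them, so they hold at most [q] pixels. *)
Lemma card_checker_box (A : {fset int * int}) (u0 v0 : int) (p q : nat) :
  (forall z, z \in A ->
     u0 <= usum z < u0 + p%:Z /\ v0 <= vdiff z < v0 + q%:Z) ->
  (2 * #|` A| <= p * q + 1)%N.
Proof.
have two_lines (B : {fset int * int}) (a : int) :
    (forall z, z \in B -> a <= usum z < a + 2 /\ v0 <= vdiff z < v0 + q%:Z) ->
    (#|` B| <= q)%N.
  move=> HB; have <- : #|` vdiff @` B| = #|` B|.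
    rewrite card_in_imfset// => -[x y] [x' y'] /HB[+ _] /HB[+ _]; rewrite /usum /vdiff /= => h1 h2 h3.
    by congr (_, _); lia.
  by apply: (@card_fset_int_le _ v0) => _ /imfsetP[z /= /HB[_ h] ->].
elim/ltn_ind: p A => -[|[|p]] IH A HA.
- rewrite (_ : A = fset0) ?cardfs0//; apply/fsetP => z.
  by rewrite in_fset0; apply/negP => /HA; lia.
- have injv : {in A &, injective vdiff}.
    move=> [x y] [x' y'] /HA[+ _] /HA[+ _]; rewrite /usum /vdiff /= => h1 h2 h3.
    by congr (_, _); lia.
  (* On a single antidiagonal all values of [vdiff] have one parity, so [V] and [V + 1] are disjoint
     subsets of an interval of length [q + 1]. *)
  pose V := vdiff @` A; pose V1 := (fun x : int => x + 1) @` V.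
  have cV : #|` V| = #|` A| by rewrite /V card_in_imfset.
  have cV1 : #|` V1| = #|` A|.
    by rewrite /V1 -cV (card_imfset _ _ (@addIr _ 1)).
  have VI : V `&` V1 = fset0.
    apply/fsetP => x; rewrite in_fsetI in_fset0; apply/negP => /andP[].
    move=> /imfsetP[z /= /HA[h1 _] ->] /imfsetP[_ /= /imfsetP[t /= /HA[h2 _] ->]].
    by move: h1 h2; rewrite /usum /vdiff; lia.
  have /card_fset_int_le : forall x, x \in V `|` V1 -> v0 <= x < v0 + q.+1%:Z.
    move=> x; rewrite in_fsetU => /orP[/imfsetP[z /= /HA[_ h] ->]|]; first by lia.
    by move=> /imfsetP[_ /= /imfsetP[z /= /HA[_ h] ->] ->]; lia.
  by rewrite cardfsU VI cardfs0 cV cV1; lia.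
- pose B := [fset z in A | usum z < u0 + p%:Z].
  have hB : (2 * #|` B| <= p * q + 1)%N.
    by apply: IH => // z; rewrite !inE /= => /andP[/HA[]]; lia.
  have hC : (#|` A `\` B| <= q)%N.
    apply: (two_lines _ (u0 + p%:Z)) => z; rewrite !inE /= => /andP[+ zA].
    by rewrite zA /=; have [] := HA z zA; lia.
  have BA : B `<=` A by apply/fsubsetP => z; rewrite !inE => /andP[].
  have := fsubset_leq_card BA; rewrite cardfsDS// in hC.
  lia.
Qed.

Definition comp_set (d : pixel -> pixel -> nat) (I : binary_image) (z : pixel) :
  set pixel := [set y | white_connected d I z y]%classic.

Lemma white_connected_refl d (I : binary_image) z : I z -> white_connected d I z z.
Proof. by move=> Iz; exists [::]; split => //=; rewrite Iz. Qed.

Lemma white_connectedW d (I : binary_image) y z :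
  white_connected d I y z -> I y /\ I z.
Proof.
move=> [p [_ <- pI]]; split; first by case/andP: pI.
by apply: (allP pI); exact: mem_last.
Qed.

Lemma white_connected_trans d (I : binary_image) x y z :
  white_connected d I x y -> white_connected d I y z -> white_connected d I x z.
Proof.
move=> [p [hp <- pI]] [q [hq <- qI]]; exists (p ++ q); split.
- by rewrite cat_path hp.
- by rewrite last_cat.
- by move: pI qI; rewrite /= all_cat => /andP[-> ->] /andP[_ ->].
Qed.

Lemma white_connected_adj d (I : binary_image) x y :
  I x -> I y -> Defs.adjacent d x y -> white_connected d I x y.
Proof. by move=> Ix Iy xy; exists [:: y]; rewrite /= xy Ix Iy. Qed.

Lemma white_connected_sym d (I : binary_image) x y :
  (forall a b, d a b = d b a) -> white_connected d I x y -> white_connected d I y x.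
Proof.
move=> dC [p [hp <- pI]]; exists (rev (belast x p)); split.
- rewrite rev_path; rewrite (eq_path (e' := Defs.adjacent d))// => a b /=.
  by rewrite /Defs.adjacent dC.
- by case: p {hp pI} => //= a p; rewrite rev_cons last_rcons.
- have : perm_eq (last x p :: rev (belast x p)) (x :: p).
    rewrite (lastI x p) perm_sym perm_rcons perm_cons perm_sym perm_rev.
    exact: perm_refl.
  by move=> /perm_all ->.
Qed.

Lemma comp_set_component d (I : binary_image) z :
  (forall a b, d a b = d b a) -> I z -> white_component d I (comp_set d I z).
Proof.
move=> dC Iz; split.
- by exists z; exact: white_connected_refl.
- move=> x y zx zy; apply: white_connected_trans zy.
  exact: white_connected_sym.
- move=> D HD zD y Dy; apply: HD => //; apply: zD; exact: white_connected_refl.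
Qed.

(** [fset_set] returns the empty set on an infinite set, so facts about [wcomp] rest on the bound on
    component sizes. *)
Definition wcomp (d : pixel -> pixel -> nat) (I : binary_image) (z : pixel) :
  {fset int * int} := fset_set (comp_set d I z).

Lemma comp_set_finite d k (I : binary_image) z :
  (forall a b, d a b = d b a) -> white_components_size_le d k I -> I z ->
  finite_set (comp_set d I z).
Proof.
move=> dC Ik Iz; have h := Ik _ (comp_set_component _ _ _ dC Iz).
by apply: (card_le_finite h); exact: finite_II.
Qed.

Lemma compP d k (I : binary_image) z y :
  (forall a b, d a b = d b a) -> white_components_size_le d k I -> I z ->
  reflect (white_connected d I z y) (y \in wcomp d I z).
Proof.
move=> dC Ik Iz; rewrite in_fset_set; last exact: comp_set_finite dC Ik Iz.
by apply: (iffP idP); rewrite in_setE.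
Qed.

Lemma card_comp d k (I : binary_image) z :
  (forall a b, d a b = d b a) -> white_components_size_le d k I -> I z ->
  (#|` wcomp d I z| <= k)%N.
Proof.
move=> dC Ik Iz; have fin := comp_set_finite _ _ _ _ dC Ik Iz.
apply: geq_card_fset_set; exact: Ik _ (comp_set_component _ _ _ dC Iz).
Qed.

Lemma path_white_connected d (I : binary_image) x p t :
  path (Defs.adjacent d) x p -> all I (x :: p) -> t \in x :: p -> white_connected d I x t.
Proof.
elim: p x => [|y p IH] x /=.
  by move=> _ /andP[Ix _]; rewrite inE => /eqP ->; exact: white_connected_refl.
move=> /andP[xy yp] /and3P[Ix Iy pI]; rewrite inE => /predU1P[->|tp].
  exact: white_connected_refl.
apply: white_connected_trans (white_connected_adj _ _ _ _ Ix Iy xy) _.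
by apply: IH => //=; rewrite Iy.
Qed.

Lemma path_dist d (x : pixel) p :
  (forall a b, Defs.adjacent d a b -> (d8 a b <= 1)%N) ->
  path (Defs.adjacent d) x p -> (d8 x (last x p) <= size p)%N.
Proof.
move=> d8d; elim: p x => [|y p IH] x /=; first by move=> _; rewrite /d8; lia.
move=> /andP[/d8d xy /IH]; move: xy; rewrite /d8; lia.
Qed.

(** A shortest connecting path repeats no pixel and stays inside the component, so it has at most
    [k] pixels. *)
Lemma comp_dist d k (I : binary_image) z y :
  (forall a b, d a b = d b a) -> (forall a b, Defs.adjacent d a b -> (d8 a b <= 1)%N) ->
  white_components_size_le d k I -> white_connected d I z y -> (d8 z y <= k)%N.
Proof.
move=> dC d8d Ik [p [hp <- pI]].
have Iz : I z by case/andP: pI.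
case/shortenP: hp pI => q hq uq qp pI.
apply: leq_trans (path_dist d z q d8d hq) _.
apply: leq_trans (card_comp _ _ _ _ dC Ik Iz).
apply: leq_trans (leqnSn _) _; rewrite -[(size q).+1]/(size (z :: q)).
apply: uniq_leq_size => // t; rewrite inE => tq.
apply/(compP _ _ _ _ _ dC Ik Iz).
apply: path_white_connected hq _ tq; rewrite /= Iz.
by apply/allP => u /qp up; apply: (allP pI); rewrite inE up orbT.
Qed.

(** * Double counting over windows *)

(** The choice depends only on the set [comp_set d I z], so all pixels of a component share one
    representative. The default [(0, 0)] is reached only for black [z]. *)
Definition rep (d : pixel -> pixel -> nat) (I : binary_image) (z : pixel) : int * int :=
  xget (0, 0) (comp_set d I z).

Definition is_rep (d : pixel -> pixel -> nat) (I : binary_image) (r : int * int) : bool :=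
  I r && (rep d I r == r).

Lemma rep_connected (d : pixel -> pixel -> nat) (I : binary_image) z :
  I z -> white_connected d I z (rep d I z).
Proof. by move=> Iz; rewrite /rep; case: xgetP => // /(_ z) []; exact: white_connected_refl. Qed.

Lemma comp_set_eq (d : pixel -> pixel -> nat) (I : binary_image) z y :
  (forall a b, d a b = d b a) ->
  white_connected d I z y -> comp_set d I z = comp_set d I y.
Proof.
move=> dC zy; apply/seteqP; split => t; apply: white_connected_trans => //.
exact: white_connected_sym.
Qed.

Lemma rep_eq (d : pixel -> pixel -> nat) (I : binary_image) z y :
  (forall a b, d a b = d b a) ->
  white_connected d I z y -> rep d I z = rep d I y.
Proof. by move=> dC zy; rewrite /rep (@comp_set_eq _ _ z y). Qed.

Lemma rep_adj (d : pixel -> pixel -> nat) (I : binary_image) z y :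
  (forall a b, d a b = d b a) ->
  I z -> I y -> d z y = 1%N -> rep d I z = rep d I y.
Proof.
move=> dC Iz Iy zy; apply: rep_eq => //; apply: white_connected_adj => //.
by rewrite /Defs.adjacent zy.
Qed.

Lemma comp_rep (d : pixel -> pixel -> nat) (I : binary_image) z :
  (forall a b, d a b = d b a) -> I z ->
  wcomp d I (rep d I z) = wcomp d I z.
Proof.
move=> dC Iz; rewrite /wcomp (@comp_set_eq d I z (rep d I z))//.
exact: rep_connected.
Qed.

Lemma is_rep_rep (d : pixel -> pixel -> nat) (I : binary_image) z :
  (forall a b, d a b = d b a) -> I z ->
  is_rep d I (rep d I z).
Proof.
move=> dC Iz; have h := rep_connected d I z Iz.
by rewrite /is_rep (white_connectedW _ _ _ _ h).2 -(@rep_eq d I z)//=.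
Qed.

Lemma mem_comp_rep (d : pixel -> pixel -> nat) k (I : binary_image) r z :
  (forall a b, d a b = d b a) ->
  white_components_size_le d k I -> is_rep d I r ->
  (z \in wcomp d I r) = I z && (rep d I z == r).
Proof.
move=> dC Ik /andP[Ir /eqP rr]; apply/(compP _ _ _ _ _ dC Ik Ir)/andP.
  move=> rz; split; first by have [] := white_connectedW _ _ _ _ rz.
  by rewrite -(rep_eq _ _ _ _ dC rz) rr.
move=> [Iz /eqP <-]; apply: white_connected_sym => //.
exact: rep_connected.
Qed.

Lemma card_ge_sum_box (A : {fset int * int}) M :
  (\sum_(w <- box M) (w \in A) <= #|` A|)%N.
Proof.
rewrite -big_mkcond /= sum1_count -size_filter.
apply: uniq_leq_size; first by rewrite filter_uniq// uniq_box.
by move=> z; rewrite mem_filter => /andP[].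
Qed.

Lemma card_le_sum_box (A : {fset int * int}) M : {subset A <= box M} ->
  (#|` A| <= \sum_(w <- box M) (w \in A))%N.
Proof.
move=> AM; rewrite -big_mkcond /= sum1_count -size_filter.
apply: uniq_leq_size (fset_uniq A) _ => z zA.
by rewrite mem_filter zA AM.
Qed.

Lemma sum_eq_le1 (s : seq (int * int)) (P : pred (int * int)) (a : int * int) :
  uniq s -> (\sum_(r <- s | P r) (a == r) <= 1)%N.
Proof.
move=> us; rewrite -big_mkcondr /= sum1_count -size_filter.
apply: (@uniq_leq_size _ _ [:: a]); first by rewrite filter_uniq.
by move=> z; rewrite mem_filter inE => /andP[/andP[_ /eqP ->]].
Qed.

Lemma rep_box (d : pixel -> pixel -> nat) k (I : binary_image) m z :
  (forall a b, d a b = d b a) ->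
  (forall a b, Defs.adjacent d a b -> (d8 a b <= 1)%N) ->
  white_components_size_le d k I -> I z -> z \in box m -> rep d I z \in box (m + k).
Proof.
move=> dC d8d Ik Iz; have /(comp_dist _ _ _ _ _ dC d8d Ik) := rep_connected d I z Iz.
by rewrite !mem_box /d8; lia.
Qed.

Lemma comp_box (d : pixel -> pixel -> nat) k (I : binary_image) m z t :
  (forall a b, d a b = d b a) ->
  (forall a b, Defs.adjacent d a b -> (d8 a b <= 1)%N) ->
  white_components_size_le d k I -> I z -> z \in box m ->
  t \in wcomp d I z -> t \in box (m + k).
Proof.
move=> dC d8d Ik Iz + /(compP _ _ _ _ _ dC Ik Iz) /(comp_dist _ _ _ _ _ dC d8d Ik).
by rewrite !mem_box /d8; lia.
Qed.

(** Each white pixel of the box is counted in its own component, whose representative lies at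
    distance at most [k]. *)
Lemma sum_white_le (d : pixel -> pixel -> nat) k (I : binary_image) m :
  (forall a b, d a b = d b a) ->
  (forall a b, Defs.adjacent d a b -> (d8 a b <= 1)%N) ->
  white_components_size_le d k I ->
  (\sum_(z <- box m) I z <= \sum_(r <- box (m + k) | is_rep d I r) #|` wcomp d I r|)%N.
Proof.
move=> dC d8d Ik.
apply: (@leq_trans (\sum_(r <- box (m + k) | is_rep d I r)
    \sum_(z <- box m) (z \in wcomp d I r))%N); last first.
  by apply: leq_sum => r _; exact: card_ge_sum_box.
rewrite exchange_big /=.
rewrite big_seq [leqRHS]big_seq; apply: leq_sum => z zm.
case Iz: (I z) => //.
have rm := rep_box _ _ _ _ _ dC d8d Ik Iz zm.
rewrite -big_filter (bigD1_seq (rep d I z)) ?filter_uniq ?uniq_box ?mem_filter ?is_rep_rep ?rm//=.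
by rewrite (mem_comp_rep _ _ _ _ _ dC Ik) ?is_rep_rep// Iz eqxx.
Qed.

Lemma shiftNK (a b : int) z : pshift (- a) (- b) (pshift a b z) = z.
Proof. by case: z => x y; rewrite /pshift /=; congr (_, _); lia. Qed.

Lemma mem_imshift (a b : int) (A : {fset int * int}) w :
  (w \in pshift a b @` A) = (pshift (- a) (- b) w \in A).
Proof.
apply/imfsetP/idP => /= [[z zA ->]|wA]; first by rewrite shiftNK.
by exists (pshift (- a) (- b) w) => //; rewrite -[X in pshift X]opprK -[X in pshift _ X]opprK shiftNK.
Qed.

Lemma mem_square_hull A w : (w \in square_hull A) =
  [|| w \in A, pshift 1 0 w \in A, pshift 0 1 w \in A | pshift 1 1 w \in A].
Proof.
rewrite /square_hull !(in_fsetU, mem_imshift) !opprK oppr0 -!orbA.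
have -> // : pshift 1 0 (pshift 0 1 w) = pshift 1 1 w.
by rewrite /pshift /=; congr (_, _); lia.
Qed.

Lemma mem_diag_hull A w : (w \in diag_hull A) = (w \in A) || (pshift 1 1 w \in A).
Proof. by rewrite /diag_hull !(in_fsetU, mem_imshift) !opprK. Qed.

Lemma mem_antidiag_hull A w :
  (w \in antidiag_hull A) = (pshift 1 0 w \in A) || (pshift 0 1 w \in A).
Proof. by rewrite /antidiag_hull !(in_fsetU, mem_imshift) !opprK oppr0. Qed.

Definition window_count (I : binary_image) (w : int * int) : nat :=
  (I w + I (pshift 1 0 w) + I (pshift 0 1 w) + I (pshift 1 1 w))%N.

Lemma d4C a b : d4 a b = d4 b a.
Proof. by rewrite /d4; lia. Qed.

Lemma d8C a b : d8 a b = d8 b a.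
Proof. by rewrite /d8; lia. Qed.

Lemma adj4_d8 a b : Defs.adjacent d4 a b -> (d8 a b <= 1)%N.
Proof. by rewrite /Defs.adjacent /d4 /d8; lia. Qed.

Lemma adj8_d8 a b : Defs.adjacent d8 a b -> (d8 a b <= 1)%N.
Proof. by rewrite /Defs.adjacent => /eqP ->. Qed.

(** Any two pixels of a window are 8-adjacent, so a window meets at most one component. *)
Lemma sum_square_hull k (I : binary_image) M :
  white_components_size_le d8 k I ->
  (\sum_(r <- box M | is_rep d8 I r) #|` square_hull (wcomp d8 I r)|
     <= size (box (M + k + 1)))%N.
Proof.
move=> Ik.
apply: (@leq_trans (\sum_(r <- box M | is_rep d8 I r)
    \sum_(w <- box (M + k + 1)) (w \in square_hull (wcomp d8 I r)))%N).
  rewrite big_seq_cond [leqRHS]big_seq_cond; apply: leq_sum => r /andP[rM rr].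
  apply: card_le_sum_box => w; rewrite mem_square_hull.
  have Ir : I r by case/andP: rr.
  by case/or4P => /(comp_box _ _ _ _ _ _ d8C adj8_d8 Ik Ir rM);
    rewrite !mem_box /pshift /=; lia.
rewrite exchange_big -sum1_size; apply: leq_sum => w _.
have [r0 Hr0] : exists r0, forall r, is_rep d8 I r ->
    w \in square_hull (wcomp d8 I r) -> r0 = r.
  have key x y : d8 x y = 1%N -> I x -> I y -> rep d8 I x = rep d8 I y.
    by move=> xy Ix Iy; exact: rep_adj d8C Ix Iy xy.
  have H r : is_rep d8 I r -> w \in square_hull (wcomp d8 I r) ->
      [\/ I w /\ rep d8 I w = r, I (pshift 1 0 w) /\ rep d8 I (pshift 1 0 w) = r,
       I (pshift 0 1 w) /\ rep d8 I (pshift 0 1 w) = r |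
       I (pshift 1 1 w) /\ rep d8 I (pshift 1 1 w) = r].
    move=> rr; rewrite mem_square_hull !(mem_comp_rep _ _ _ _ _ d8C Ik rr).
    case/or4P => /andP[Iz /eqP zr]; [exact: Or41|exact: Or42|exact: Or43|exact: Or44].
  have d1 : d8 w (pshift 1 0 w) = 1%N by rewrite /d8 /pshift /=; lia.
  have d2 : d8 w (pshift 0 1 w) = 1%N by rewrite /d8 /pshift /=; lia.
  have d3 : d8 w (pshift 1 1 w) = 1%N by rewrite /d8 /pshift /=; lia.
  have d5 : d8 (pshift 1 0 w) (pshift 0 1 w) = 1%N by rewrite /d8 /pshift /=; lia.
  have d6 : d8 (pshift 1 0 w) (pshift 1 1 w) = 1%N by rewrite /d8 /pshift /=; lia.
  have d7 : d8 (pshift 0 1 w) (pshift 1 1 w) = 1%N by rewrite /d8 /pshift /=; lia.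
  (* The first white pixel of the window determines the only possible component. *)
  exists (if I w then rep d8 I w else if I (pshift 1 0 w) then rep d8 I (pshift 1 0 w)
     else if I (pshift 0 1 w) then rep d8 I (pshift 0 1 w) else rep d8 I (pshift 1 1 w)).
  move=> r rr /(H _ rr).
  case: ifP => Iw; first by case=> -[Iz <-] //; apply: key.
  case: ifP => Iw1; first by case=> -[Iz <-] //; by [rewrite Iz in Iw|apply: key].
  case: ifP => Iw2; first by case=> -[Iz <-] //; by [rewrite Iz in Iw|rewrite Iz in Iw1|apply: key].
  by case=> -[Iz <-] //; by [rewrite Iz in Iw|rewrite Iz in Iw1|rewrite Iz in Iw2].
apply: leq_trans (sum_eq_le1 _ (is_rep d8 I) r0 (uniq_box M)).
apply: leq_sum => r rr; case: (boolP (w \in _)) => // /(Hr0 _ rr) ->.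
by rewrite eqxx.
Qed.

Lemma sum_diag_hulls k (I : binary_image) M :
  white_components_size_le d4 k I ->
  (\sum_(r <- box M | is_rep d4 I r)
      (#|` diag_hull (wcomp d4 I r)| + #|` antidiag_hull (wcomp d4 I r)|)
   + \sum_(w <- box (M + k + 1)) (window_count I w <= 1)
     <= 2 * size (box (M + k + 1)))%N.
Proof.
move=> Ik; set M' := (M + k + 1)%N.
apply: (@leq_trans (\sum_(r <- box M | is_rep d4 I r)
    \sum_(w <- box M') ((w \in diag_hull (wcomp d4 I r)) +
       (w \in antidiag_hull (wcomp d4 I r))) +
    \sum_(w <- box M') (window_count I w <= 1)%N)%N).
  rewrite leq_add2r big_seq_cond [leqRHS]big_seq_cond; apply: leq_sum => r /andP[rM rr].
  have Ir : I r by case/andP: rr.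
  rewrite big_split /=; apply: leq_add; apply: card_le_sum_box => w;
    rewrite ?mem_diag_hull ?mem_antidiag_hull => /orP[];
    move=> /(comp_box _ _ _ _ _ _ d4C adj4_d8 Ik Ir rM);
    rewrite !mem_box /pshift /=; lia.
rewrite exchange_big -big_split -sum1_size big_distrr; apply: leq_sum => w _.
(* [S a b] counts the components meeting the pair [a], [b]. *)
pose S a b := (\sum_(r <- box M | is_rep d4 I r)
   ((I a && (rep d4 I a == r)) || (I b && (rep d4 I b == r))))%N.
have -> : (\sum_(r <- box M | is_rep d4 I r)
     ((w \in diag_hull (wcomp d4 I r)) + (w \in antidiag_hull (wcomp d4 I r))) =
   S w (pshift 1 1 w) + S (pshift 1 0 w) (pshift 0 1 w))%N.
  rewrite -big_split /=; apply: eq_bigr => r rr.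
  by rewrite mem_diag_hull mem_antidiag_hull !(mem_comp_rep _ _ _ _ _ d4C Ik rr).
have S1 a : (\sum_(r <- box M | is_rep d4 I r) (I a && (rep d4 I a == r)) <= I a)%N.
  case: (I a) => /=; last by rewrite big1.
  exact: sum_eq_le1 (uniq_box M).
have S2 a b : (S a b <= I a + I b)%N.
  apply: leq_trans (leq_add (S1 a) (S1 b)); rewrite /S -big_split /=.
  by apply: leq_sum => r _; case: (_ && _); case: (_ && _).
have S3 a b : rep d4 I a = rep d4 I b -> (S a b <= 1)%N.
  move=> E; apply: leq_trans (sum_eq_le1 _ (is_rep d4 I) (rep d4 I a) (uniq_box M)).
  by rewrite /S -E; apply: leq_sum => r _; case: (_ == r); rewrite ?andbF ?andbT //; case: (_ || _).
have key x y : d4 x y = 1%N -> I x -> I y -> rep d4 I x = rep d4 I y.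
  by move=> xy Ix Iy; exact: rep_adj d4C Ix Iy xy.
have d1 : d4 w (pshift 1 0 w) = 1%N by rewrite /d4 /pshift /=; lia.
have d2 : d4 w (pshift 0 1 w) = 1%N by rewrite /d4 /pshift /=; lia.
have d3 : d4 (pshift 1 0 w) (pshift 1 1 w) = 1%N by rewrite /d4 /pshift /=; lia.
have d5 : d4 (pshift 0 1 w) (pshift 1 1 w) = 1%N by rewrite /d4 /pshift /=; lia.
have T1 : I (pshift 1 0 w) -> I (pshift 0 1 w) -> I w || I (pshift 1 1 w) ->
    (S (pshift 1 0 w) (pshift 0 1 w) <= 1)%N.
  move=> h1 h2 /orP[h|h]; apply: S3.
    by rewrite -(key _ _ d1)// -(key _ _ d2).
  by rewrite (key _ _ d3)// (key _ _ d5).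
have T2 : I w -> I (pshift 1 1 w) -> I (pshift 1 0 w) || I (pshift 0 1 w) ->
    (S w (pshift 1 1 w) <= 1)%N.
  move=> h1 h2 /orP[h|h]; apply: S3.
    by rewrite (key _ _ d1)// (key _ _ d3).
  by rewrite (key _ _ d2)// (key _ _ d5).
have := S2 w (pshift 1 1 w); have := S2 (pshift 1 0 w) (pshift 0 1 w).
rewrite /window_count; move: T1 T2; move: (S _ _) (S _ _) => s1 s2.
case: (I w); case: (I (pshift 1 0 w)); case: (I (pshift 0 1 w));
  case: (I (pshift 1 1 w)) => /= T1 T2; try lia.
all: try have := T1 isT isT isT.
all: try have := T2 isT isT isT.
all: lia.
Qed.

(** * Diagonal extents of 4-components *)

Lemma path_ivt (d : pixel -> pixel -> nat) (f : pixel -> int) x p (b : int) :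
  (forall s t, Defs.adjacent d s t -> (`|(f s - f t)%R| <= 1)%N) ->
  path (Defs.adjacent d) x p -> f x <= b <= f (last x p) ->
  exists2 t, t \in x :: p & f t = b.
Proof.
move=> f1; elim: p x => [|y p IH] x /=.
  by move=> _ h; exists x; rewrite ?inE//; lia.
move=> /andP[/f1 xy yp] h; case: (eqVneq (f x) b) => [fx|fx].
  by exists x; rewrite ?inE ?eqxx.
have [|t tp ft] := IH y yp; first by lia.
by exists t; rewrite // in_cons tp orbT.
Qed.

(* The number of pairs (window, diagonal pair of pixels in it) touched by [A]. *)
Definition touch4 (A : {fset int * int}) : nat :=
  (#|` diag_hull A| + #|` antidiag_hull A|)%N.

(** A coordinate that changes by at most one along each step takes every intermediate value on a
    path inside the component. *)
Lemma comp_image_convex k (I : binary_image) z (f : int * int -> int) (a b c : int) :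
  (forall s t, Defs.adjacent d4 s t -> (`|(f s - f t)%R| <= 1)%N) ->
  white_components_size_le d4 k I -> I z ->
  a \in f @` wcomp d4 I z -> c \in f @` wcomp d4 I z -> a <= b <= c ->
  b \in f @` wcomp d4 I z.
Proof.
move=> f1 Ik Iz /imfsetP[s /= /(compP _ _ _ _ _ d4C Ik Iz) zs ->].
move=> /imfsetP[t /= /(compP _ _ _ _ _ d4C Ik Iz) zt ->] sbt.
have [p [hp pt pI]] : white_connected d4 I s t.
  by apply: white_connected_trans zt; apply: white_connected_sym d4C zs.
rewrite -pt in sbt.
have [y yp fy] := path_ivt _ _ _ _ _ f1 hp sbt.
apply/imfsetP; exists y => //=; apply/(compP _ _ _ _ _ d4C Ik Iz).
by apply: white_connected_trans zs _; apply: path_white_connected hp pI yp.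
Qed.

Lemma comp4_in_box k (I : binary_image) z :
  white_components_size_le d4 k I -> I z ->
  exists u0 v0, forall t, t \in wcomp d4 I z ->
    u0 <= usum t < u0 + #|` usum @` wcomp d4 I z|%:Z /\
    v0 <= vdiff t < v0 + #|` vdiff @` wcomp d4 I z|%:Z.
Proof.
move=> Ik Iz; have zz : z \in wcomp d4 I z.
  by apply/(compP _ _ _ _ _ d4C Ik Iz); exact: white_connected_refl.
have ne (f : int * int -> int) : f @` wcomp d4 I z != fset0.
  by apply/fset0Pn; exists (f z); apply/imfsetP; exists z.
have u1 s t : Defs.adjacent d4 s t -> (`|(usum s - usum t)%R| <= 1)%N.
  by rewrite /Defs.adjacent /d4 /usum; lia.
have v1 s t : Defs.adjacent d4 s t -> (`|(vdiff s - vdiff t)%R| <= 1)%N.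
  by rewrite /Defs.adjacent /d4 /vdiff; lia.
have [|u0 Hu] := fset_int_interval _ (ne usum).
  by move=> a b c; exact: comp_image_convex u1 Ik Iz.
have [|v0 Hv] := fset_int_interval _ (ne vdiff).
  by move=> a b c; exact: comp_image_convex v1 Ik Iz.
exists u0, v0 => t tC; rewrite -Hu -Hv.
by split; apply/imfsetP; exists t.
Qed.

Lemma touch4_lower (A : {fset int * int}) :
  (2 * #|` A| + (#|` usum @` A| + #|` vdiff @` A|) <= touch4 A)%N.
Proof. by have := card_diag_hull A; have := card_antidiag_hull A; rewrite /touch4; lia. Qed.

(** If [p] antidiagonals and [q] diagonals are occupied, the box capacity gives [p * q >= 2 * j - 1]
    for size [j], and AM-GM turns this into a bound on [p + q]. *)
Lemma touch4_ge k (I : binary_image) z :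
  white_components_size_le d4 k I -> I z ->
  (2 * #|` wcomp d4 I z| + ceil2sqrt (2 * #|` wcomp d4 I z| - 1) <= touch4 (wcomp d4 I z))%N.
Proof.
move=> Ik Iz; have [u0 [v0 /card_checker_box H]] := comp4_in_box _ _ _ Ik Iz.
apply: leq_trans (touch4_lower _); rewrite leq_add2l; apply: ceil2sqrt_le.
by apply: leq_trans (nat_AGM2 _ _); rewrite leq_mul2l /= leq_subLR addnC.
Qed.

(** Stability of AM-GM: with sum at most [2 * c + 1] the largest product is [c * (c + 1)]. The next
    candidates [c * c] and [(c - 1) * (c + 2)] fall short by [c] and [2], more than the tolerance
    [1] left by the capacity bound. *)
Lemma near_square_factors (p e c : nat) : (2 <= c)%N -> (2 * p + e <= c.*2.+1)%N ->
  (c * c.+1 <= p * (p + e) + 1)%N -> e = 1%N /\ p = c.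
Proof.
move=> c2 h1 h2.
have h3 : ((2 * p + e) * (2 * p + e) <= c.*2.+1 * c.*2.+1)%N by rewrite leq_mul.
(* From [(2 * p + e) ^ 2 = 4 * p * (p + e) + e ^ 2] and [(2 * c + 1) ^ 2 = 4 * c * (c + 1) + 1]. *)
have e2 : (e * e <= 5)%N by nia.
have {e2} : (e <= 2)%N by rewrite leqNgt; apply/negP => e3; nia.
have pc : (p <= c)%N by lia.
case: e h1 h2 h3 => [|[|[|]]]// h1 h2 _ _.
- have : (p * p <= c * c)%N by rewrite leq_mul.
  nia.
- split=> //; apply/eqP; rewrite eqn_leq pc leqNgt /=; apply/negP => pc'.
  have : (p * p <= p * c)%N by rewrite leq_mul.
  nia.
- have : (p.+1 * p.+1 <= c * c)%N by rewrite leq_mul//; lia.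
  nia.
Qed.

(** Equality in the perimeter bound forces a [c] by [c + 1] bounding box in rotated coordinates. As
    [c * (c + 1)] is even, a pixel of the box missing from the component could be added to it in
    violation of the capacity bound. *)
Lemma touch4_perfect k (I : binary_image) z c : (2 <= c)%N ->
  white_components_size_le d4 k I -> I z ->
  (2 * #|` wcomp d4 I z| = c * c.+1)%N ->
  (touch4 (wcomp d4 I z) <= 2 * #|` wcomp d4 I z| + c.*2.+1)%N ->
  exists u0 v0 p q,
    (p = c /\ q = c.+1 \/ p = c.+1 /\ q = c) /\
    forall t, (t \in wcomp d4 I z) =
      (u0 <= usum t < u0 + p%:Z) && (v0 <= vdiff t < v0 + q%:Z).
Proof.
move=> c2 Ik Iz cardC tC; have [u0 [v0 H]] := comp4_in_box _ _ _ Ik Iz.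
have Hc := card_checker_box _ _ _ _ _ H; have Hl := touch4_lower (wcomp d4 I z).
move: H Hc Hl; set A := wcomp d4 I z in cardC tC *.
set p := #|` usum @` A|; set q := #|` vdiff @` A| => H Hc Hl.
have pqc : (p + q <= c.*2.+1)%N by lia.
have pqE : (p = c /\ q = c.+1 \/ p = c.+1 /\ q = c)%N.
  clear -c2 cardC pqc Hc; move: Hc; rewrite cardC; move: p q pqc => p q.
  move=> h1 h2.
  case: (leqP p q) => pq.
    have [||e1 pE] := near_square_factors p (q - p) c c2; first by lia.
      by rewrite subnKC.
    by left; lia.
  have [||e1 pE] := near_square_factors q (p - q) c c2; first by lia.
    by rewrite (subnKC (ltnW pq)) [(q * p)%N]mulnC.
  by right; lia.
exists u0, v0, p, q; split => // t; apply/idP/idP => [/H[-> ->]//|/andP[hu hv]].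
apply: contraT => tA.
have : (2 * #|` t |` A| <= p * q + 1)%N.
  by apply: (card_checker_box _ u0 v0) => s; rewrite in_fset1U => /predU1P[->|/H].
have -> : (p * q = c * c.+1)%N by case: pqE => -[-> ->]; rewrite // mulnC.
by rewrite -cardC cardfsU1 tA mulnDr /= muln1; lia.
Qed.

(** * Full boxes do not fit together *)

Local Close Scope fset_scope.

(* In the coordinates s + t and s - t the component of (a, b) is a full box whose
   side s - t = a - b has flat corners at both ends. Each flat corner faces a flat
   corner of another component (through (a, b - 2), resp. (a' + 1, b' - 1) below).
   The component of (a + 1, b - 1) facing the left end of this side starts there,
   and being at least as long as the side it runs into the component facing the
   right flat corner. *)
Lemma corner_contradiction (c m q : nat) (a b : int)
    (G : int -> int -> bool) (C : int -> int -> int -> int -> bool) :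
  (2 <= c)%N -> (1 <= m)%N -> (m.*2 <= c)%N -> (2 <= q)%N ->
  (forall s t s' t' : int, G s t -> C s t s' t' ->
     G s' t' /\ forall x y : int, C s t x y = C s' t' x y) ->
  (forall s t s' t' : int, G s t -> G s' t' ->
     (`|(s - s')%R| + `|(t - t')%R| <= 1)%N -> C s t s' t') ->
  (forall s t : int, (`|(s - a)%R| <= c + 3)%N -> (`|(t - b)%R| <= c + 3)%N ->
     (2 <= G s t + G (s + 1)%R t + G s (t + 1)%R + G (s + 1)%R (t + 1)%R)%N) ->
  (forall s t : int, (`|(s - a)%R| <= c + 3)%N -> (`|(t - b)%R| <= c + 3)%N -> G s t ->
     exists (u0 v0 : int) (p' q' : nat), [/\ (c <= p')%N, (c <= q')%N &
     forall s' t' : int, C s t s' t' =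
       (u0 <= s' + t' < u0 + p'%:Z) && (v0 <= s' - t' < v0 + q'%:Z)]) ->
  G a b ->
  (forall s t : int, C a b s t =
     (a + b - 1 <= s + t < a + b + m.*2%:Z) && (a - b - q%:Z < s - t <= a - b)) ->
  False.
Proof.
move=> c2 m1 mc q2 Ceq Cadj win bx Gab Cab.
have black (s t s' t' : int) : C a b s t -> ~~ C a b s' t' ->
    (`|(s - s')%R| + `|(t - t')%R| <= 1)%N -> G s' t' = false.
  move=> Cs Cs' dst; apply/negP => Gs'; move/negP: Cs'; apply.
  have [Gs ->] := Ceq _ _ _ _ Gab Cs.
  exact: Cadj.
have sub1 (x : int) : x - 1 + 1 = x by lia.
have sub2 (x : int) : x - 2 + 1 = x - 1 by lia.
have B1 : G a (b - 1) = false by apply: (black a b); rewrite ?Cab; clear -m1 q2; lia.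
have B2 : G (a - 1) (b - 1) = false by apply: (black (a - 1) b); rewrite ?Cab; clear -m1 q2; lia.
have B3 : G (a + 1) b = false by apply: (black a b); rewrite ?Cab; clear -m1 q2; lia.
have W1 : G (a - 1) (b - 2) && G a (b - 2).
  have := win (a - 1) (b - 2); rewrite sub1 sub2 B1 B2.
  by case: (G (a - 1) _); case: (G a _) => //= h; apply: h; clear; lia.
have /andP[W1a W1b] := W1.
have W2 : G (a + 1) (b - 1).
  have := win a (b - 1); rewrite sub1 B1 B3.
  by case: (G (a + 1) _) => //= h; have := h _ _; case: (G a b) h => h; lia.
(* Otherwise [(a - 1, b - 2)], [(a, b - 2)], [(a + 1, b - 2)] lie in one component, and a rotated
   box containing them also contains the black pixel [(a, b - 1)]. *)
have B4 : G (a + 1) (b - 2) = false.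
  apply/negP => W.
  have [|||u [v [p' [q' [_ _ H]]]]] := bx a (b - 2); [clear; lia|clear; lia|by []|].
  have h1 : C a (b - 2) (a + 1) (b - 2) by apply: Cadj => //; clear; lia.
  have h2 : C a (b - 2) (a - 1) (b - 2) by apply: Cadj => //; clear; lia.
  have [] := Ceq a (b - 2) a (b - 1); rewrite ?B1 //.
  by move: h1 h2; rewrite !H; clear; lia.
pose a' := a + m%:Z; pose b' := b + m%:Z.
have B5 : G a' (b' - 1) = false.
  by apply: (black (a' - 1) (b' - 1)); rewrite /a' /b' ?Cab; clear -m1 q2; lia.
have B6 : G a' b' = false.
  by apply: (black (a' - 1) b'); rewrite /a' /b' ?Cab; clear -m1 q2; lia.
have W3 : G (a' + 1) (b' - 1) && G (a' + 1) b'.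
  have := win a' (b' - 1); rewrite sub1 B5 B6.
  by case: (G (a' + 1) b'); case: (G (a' + 1) _) => //= h; apply: h; rewrite /a' /b'; clear -mc; lia.
have /andP[W3a W3b] := W3.
have [|||u [v [p' [q' [cp cq H]]]]] := bx (a + 1) (b - 1); [clear; lia|clear; lia|by []|].
have HG (s t : int) : C (a + 1) (b - 1) s t -> G s t by move=> /(Ceq _ _ _ _ W2)[].
have D0 : C (a + 1) (b - 1) (a + 1) (b - 1).
  by apply: Cadj => //; clear; lia.
have D1 : C (a + 1) (b - 1) a (b - 1) = false by apply/negP => /HG; rewrite B1.
have D2 : C (a + 1) (b - 1) (a + 1) b = false by apply/negP => /HG; rewrite B3.
have D3 : C (a + 1) (b - 1) (a + 1) (b - 2) = false by apply/negP => /HG; rewrite B4.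
(* The three black neighbours force the box of [(a + 1, b - 1)] to begin at [s + t = a + b] and
   [s - t = a - b + 2]; since its sides are at least [c >= 2 * m], it reaches [(a' + 1, b' - 2)].
   This makes three consecutive white pixels in column [a' + 1], excluded as in [B4] by the black
   pixel [(a', b' - 1)]. *)
have D4 : C (a + 1) (b - 1) (a' + 1) (b' - 2).
  move: D0 D1 D2 D3; rewrite !H /a' /b'; clear -cp cq m1 mc c2; lia.
have W4 := HG _ _ D4.
have [|||u' [v' [p2 [q2' [_ _ H']]]]] := bx (a' + 1) (b' - 1); rewrite /a' /b'; [clear -mc; lia|clear -mc; lia|by []|].
have h1 : C (a' + 1) (b' - 1) (a' + 1) (b' - 2) by apply: Cadj => //; clear; lia.
have h2 : C (a' + 1) (b' - 1) (a' + 1) b' by apply: Cadj => //; clear; lia.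
have [] := Ceq (a' + 1) (b' - 1) a' (b' - 1); rewrite ?B5 //.
by move: h1 h2; rewrite !H'; clear; lia.
Qed.

(** The distinguished side may face any of four directions. The map [f] is a grid symmetry bringing
    it to the standard position: it preserves distances and respects windows and rotated boxes. *)
Lemma corner_contradiction_image k (I : binary_image) (c m q : nat) (a b : int)
    (f : int -> int -> pixel) (z0 : pixel) (K : nat) :
  white_components_size_le d4 k I ->
  (2 <= c)%N -> (1 <= m)%N -> (m.*2 <= c)%N -> (2 <= q)%N ->
  (forall s t s' t' : int, d4 (f s t) (f s' t') = (`|(s - s')%R| + `|(t - t')%R|)%N) ->
  (forall s t : int, exists2 w, (d8 w (f s t) <= 1)%N &
     window_count I w = (I (f s t) + I (f (s + 1)%R t) + I (f s (t + 1)%R)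
        + I (f (s + 1)%R (t + 1)%R))%N) ->
  (forall (u0 v0 : int) (p q : nat), (c <= p)%N -> (c <= q)%N ->
     exists (u1 v1 : int) (p' q' : nat), [/\ (c <= p')%N, (c <= q')%N &
     forall s t : int, (u0 <= usum (f s t) < u0 + p%:Z) && (v0 <= vdiff (f s t) < v0 + q%:Z)
      = (u1 <= s + t < u1 + p'%:Z) && (v1 <= s - t < v1 + q'%:Z)]) ->
  (d8 (f a b) z0 + c.*2 + 7 <= K)%N ->
  (forall w, (d8 w z0 <= K)%N -> (2 <= window_count I w)%N) ->
  (forall z, I z -> (d8 z z0 <= K)%N -> exists (u0 v0 : int) (p q : nat),
     [/\ (c <= p)%N, (c <= q)%N & forall t, (t \in wcomp d4 I z) =
      (u0 <= usum t < u0 + p%:Z) && (v0 <= vdiff t < v0 + q%:Z)]) ->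
  I (f a b) ->
  (forall s t : int, (f s t \in wcomp d4 I (f a b)) =
     (a + b - 1 <= s + t < a + b + m.*2%:Z) && (a - b - q%:Z < s - t <= a - b)) ->
  False.
Proof.
move=> Ik c2 m1 mc q2 fd fw fb near win bx Iab Cab.
(* Two offsets of at most [c + 3] give distance at most [2 * c + 6]; one more unit allows for the
   change of the named corner of a window under [f]. *)
have near1 (s t : int) w : (`|(s - a)%R| <= c + 3)%N -> (`|(t - b)%R| <= c + 3)%N ->
    (d8 w (f s t) <= 1)%N -> (d8 w z0 <= K)%N.
  move=> h1 h2; have := fd s t a b; move: near; rewrite /d8 /d4; clear -h1 h2; lia.
apply: (@corner_contradiction c m q a b (fun s t => I (f s t))
  (fun s t s' t' => f s' t' \in wcomp d4 I (f s t))) => //.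
- move=> s t s' t' Is /(compP _ _ _ _ _ d4C Ik Is) st.
  have [_ Is'] := white_connectedW _ _ _ _ st; split=> // x y.
  by rewrite /wcomp (comp_set_eq _ _ _ _ d4C st).
- move=> s t s' t' Is Is' dst; apply/(compP _ _ _ _ _ d4C Ik Is).
  case: (posnP (d4 (f s t) (f s' t'))) => d0.
    have -> : f s' t' = f s t.
      move: d0; case: (f s t) (f s' t') => [x y] [x' y']; rewrite /d4 /= => h.
      by congr (_, _); clear -h; lia.
    exact: white_connected_refl.
  apply: white_connected_adj => //; rewrite /Defs.adjacent eqn_leq d0 andbT.
  by rewrite fd.
- move=> s t h1 h2; have [w wn <-] := fw s t.
  by apply: win; apply: near1 h1 h2 wn.
- move=> s t h1 h2 Is; have [||u0 [v0 [p [q' [cp cq H]]]]] := bx (f s t) => //.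
    by apply: near1 h1 h2 _; rewrite /d8; clear; lia.
  have [u1 [v1 [p1 [q1 [cp1 cq1 H1]]]]] := fb u0 v0 p q' cp cq.
  by exists u1, v1, p1, q1; split => // s' t'; rewrite H H1.
Qed.

Lemma pixel_of_uv (u v e : int) :
  u - v = 2 * e -> exists y : pixel, usum y = u /\ vdiff y = v.
Proof. by move=> h; exists (v + e, e); rewrite /usum /vdiff /=; lia. Qed.

Lemma no_perfect_patch k (I : binary_image) (c : nat) (z0 : pixel) :
  white_components_size_le d4 k I -> (2 <= c)%N ->
  (forall w, (d8 w z0 <= 3 * c + 8)%N -> (2 <= window_count I w)%N) ->
  (forall z, I z -> (d8 z z0 <= 3 * c + 8)%N -> exists (u0 v0 : int) (p q : nat),
     (p = c /\ q = c.+1 \/ p = c.+1 /\ q = c) /\ forall t, (t \in wcomp d4 I z) =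
      (u0 <= usum t < u0 + p%:Z) && (v0 <= vdiff t < v0 + q%:Z)) ->
  False.
Proof.
move=> Ik c2 win bx.
have bx' z : I z -> (d8 z z0 <= 3 * c + 8)%N -> exists (u0 v0 : int) (p q : nat),
     [/\ (c <= p)%N, (c <= q)%N & forall t, (t \in wcomp d4 I z) =
      (u0 <= usum t < u0 + p%:Z) && (v0 <= vdiff t < v0 + q%:Z)].
  move=> Iz /(bx z Iz) [u0 [v0 [p [q [pq H]]]]]; exists u0, v0, p, q.
  by split=> //; clear -pq; lia.
have [z [Iz zn]] : exists z, I z /\ (d8 z z0 <= 1)%N.
  have := win z0; rewrite /window_count => /(_ _).
  have d0 : (d8 z0 z0 <= 3 * c + 8)%N by rewrite /d8; clear; lia.
  move=> /(_ d0).
  case E1: (I z0); first by exists z0; split=> //; rewrite /d8; clear; lia.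
  case E2: (I (pshift 1 0 z0)).
    by exists (pshift 1 0 z0); split=> //; rewrite /d8 /pshift /=; clear; lia.
  case E3: (I (pshift 0 1 z0)) => //; last by case: (I _).
  by exists (pshift 0 1 z0); split=> //; rewrite /d8 /pshift /=; clear; lia.
have [|u0 [v0 [p [q [pq H]]]]] := bx z Iz; first by clear -zn; lia.
have zC : z \in wcomp d4 I z.
  by apply/(compP _ _ _ _ _ d4C Ik Iz); exact: white_connected_refl.
(* Pixels of a rotated box with sides at most [c + 1] differ by at most [c] in each coordinate, so
   [y] is within [c + 1] of [z0], leaving [2 * c + 7] of the radius [3 * c + 8]. *)
have base (y : pixel) : y \in wcomp d4 I z ->
    [/\ I y, wcomp d4 I y = wcomp d4 I z & (d8 y z0 + c.*2 + 7 <= 3 * c + 8)%N].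
  move=> yC; have zy := compP _ _ _ _ _ d4C Ik Iz yC.
  have [_ Iy] := white_connectedW _ _ _ _ zy; split=> //.
    by rewrite /wcomp (comp_set_eq _ _ _ _ d4C zy).
  move: zC yC zn; rewrite !H /usum /vdiff /d8; clear -pq c2; lia.
have [e ue] : exists e : int, u0 - v0 = 2 * e \/ u0 - v0 = 2 * e + 1.
  by exists ((u0 - v0) %/ 2)%Z; clear; lia.
(* Of the consecutive lengths [c] and [c + 1] one is odd, namely [2 * m + 1] with [m] half of [c]
   rounded down. *)
have : exists m, (1 <= m)%N /\ (m.*2 <= c)%N /\
    ((p = m.*2.+1 /\ exists2 r, q = r.*2 & (1 <= r)%N) \/
     (q = m.*2.+1 /\ exists2 r, p = r.*2 & (1 <= r)%N)).
  have Ec := odd_double_half c.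
  case: (odd c) Ec => /= Ec; exists (c./2); split; [|split| |split]; try (clear -Ec c2; lia).
    case: pq => -[-> ->]; [left|right]; (split; first by clear -Ec; lia);
      by exists (c./2).+1; clear -Ec; lia.
  case: pq => -[-> ->]; [right|left]; (split; first by clear -Ec; lia);
    by exists (c./2); clear -Ec c2; lia.
(* A side of odd length has both corners flat or both pointed, according to parity. The other
   dimension is even, so exactly one of the two opposite odd sides is flat at both ends; the parity
   of [u0 - v0] tells which. *)
move=> [m [m1 [mc [[pm [r qr r1]]|[qm [r pr r1]]]]]]; case: ue => ue.
- have [|y [yu yv]] := @pixel_of_uv (u0 + 1) (v0 + q%:Z - 1) (e - r%:Z + 1).
    by rewrite qr; clear -ue; lia.
  have [|Iy Cy yn] := base y.
    by rewrite H yu yv pm qr; clear -m1 r1; lia.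
  apply: (@corner_contradiction_image k I c m q y.1 y.2 (fun s t => (s, t)) z0 (3 * c + 8));
    rewrite -?surjective_pairing //; first by rewrite qr; clear -r1; lia.
  + by move=> s t; exists (s, t); rewrite ?/window_count /d8 /pshift /=; [clear; lia|rewrite !addr0].
  + by move=> u v p' q' cp cq; exists u, v, p', q'.
  + move=> s t; rewrite Cy H; move: yu yv; rewrite /usum /vdiff /= pm; clear; lia.
- have [|y [yu yv]] := @pixel_of_uv (u0 + 1) v0 (e + 1); first by clear -ue; lia.
  have [|Iy Cy yn] := base y.
    by rewrite H yu yv pm qr; clear -m1 r1; lia.
  apply: (@corner_contradiction_image k I c m q y.2 y.1 (fun s t => (t, s)) z0 (3 * c + 8));
    rewrite -?surjective_pairing //; first by rewrite qr; clear -r1; lia.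
  + by move=> s t s' t'; rewrite /d4 /= addnC.
  + move=> s t; exists (t, s); rewrite ?/window_count /d8 /pshift /=; first by clear; lia.
    by rewrite !addr0 /=; do 4 case: (I _).
  + move=> u v p' q' cp cq; exists u, (1 - v - q'%:Z), p', q'; split => // s t.
    by rewrite /usum /vdiff /=; clear; lia.
  + move=> s t; rewrite Cy H; move: yu yv; rewrite /usum /vdiff /= pm; clear; lia.
- have [|y [yu yv]] := @pixel_of_uv (u0 + p%:Z - 1) (v0 + 1) (e + r%:Z - 1).
    by rewrite pr; clear -ue; lia.
  have [|Iy Cy yn] := base y.
    by rewrite H yu yv qm pr; clear -m1 r1; lia.
  have yE : (y.1, - - y.2) = y by rewrite opprK -surjective_pairing.
  apply: (@corner_contradiction_image k I c m p y.1 (- y.2) (fun s t => (s, - t)) z0 (3 * c + 8));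
    rewrite ?yE //; first by rewrite pr; clear -r1; lia.
  + by move=> s t s' t'; rewrite /d4 /=; clear; lia.
  + move=> s t; exists (s, - t - 1); rewrite ?/window_count /d8 /pshift /=; first by clear; lia.
    by rewrite !addr0 subrK opprD /=; do 4 case: (I _).
  + move=> u v p' q' cp cq; exists v, u, q', p'; split => // s t.
    by rewrite /usum /vdiff /=; clear; lia.
  + move=> s t; rewrite Cy H; move: yu yv; rewrite /usum /vdiff /= qm; clear; lia.
- have [|y [yu yv]] := @pixel_of_uv u0 (v0 + 1) e; first by clear -ue; lia.
  have [|Iy Cy yn] := base y.
    by rewrite H yu yv qm pr; clear -m1 r1; lia.
  have yE : (y.1, - - y.2) = y by rewrite opprK -surjective_pairing.
  apply: (@corner_contradiction_image k I c m p (- y.2) y.1 (fun s t => (t, - s)) z0 (3 * c + 8));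
    rewrite ?yE //; first by rewrite pr; clear -r1; lia.
  + by move=> s t s' t'; rewrite /d4 /=; clear; lia.
  + move=> s t; exists (t, - s - 1); rewrite ?/window_count /d8 /pshift /=; first by clear; lia.
    by rewrite !addr0 subrK opprD /=; do 4 case: (I _).
  + move=> u v p' q' cp cq; exists v, (1 - u - p'%:Z), q', p'; split => // s t.
    by rewrite /usum /vdiff /=; clear; lia.
  + move=> s t; rewrite Cy H; move: yu yv; rewrite /usum /vdiff /= qm; clear; lia.
Qed.

(** * Upper bounds *)

Lemma ceil_2sqrtE (R : realType) (n : nat) :
  Num.ceil (2 * Num.sqrt (n%:R : R)) = ceil2sqrt n.
Proof.
apply: ceil_def; have h1 := ceil2sqrt_ge n.
have h2 : (2 : R) = Num.sqrt (4%:R).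
  by rewrite (_ : 4%:R = 2 ^+ 2) ?sqrtr_sqr ?ger0_norm// -natrX.
rewrite h2 -sqrtrM// -natrM.
have sqc (m : nat) : Num.sqrt ((m ^ 2)%:R : R) = m%:R by rewrite natrX sqrtr_sqr ger0_norm.
apply/andP; split; last first.
  by rewrite -[(ceil2sqrt n)%:~R]sqc ler_wsqrtr// ler_nat.
case E: (ceil2sqrt n) => [|m]; first by rewrite (lt_le_trans _ (sqrtr_ge0 _))// ltrz0.
have -> : (m.+1%:Z - 1)%:~R = m%:R :> R by rewrite -addn1 PoszD addrK.
rewrite -[m%:R]sqc ltr_sqrt; last by rewrite ltr0n; have := @ceil2sqrt_lt n m; rewrite E; lia.
by rewrite ltr_nat; apply: ceil2sqrt_lt; rewrite E.
Qed.

Lemma F8E (R : realType) (k : nat) :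
  F8 R k = \big[Num.max/0]_(1 <= j < k.+1) (j%:R / (j%:R + (ceil2sqrt j)%:R + 1)).
Proof. by apply: eq_bigr => j _; rewrite ceil_2sqrtE. Qed.

Lemma F4E (R : realType) (k : nat) :
  F4 R k = \big[Num.max/0]_(1 <= j < k.+1)
    ((2 * j)%:R / (2 * j + ceil2sqrt (2 * j - 1))%:R).
Proof.
rewrite /F4 big_nat_cond [RHS]big_nat_cond; apply: eq_bigr => j /andP[/andP[j1 _] _].
have -> : 2 * j%:R - 1 = (2 * j - 1)%:R :> R by rewrite natrB ?natrM//; lia.
rewrite ceil_2sqrtE natrD natrM -[X in _ = _ / X](_ : 2 * (j%:R + (ceil2sqrt (2 * j - 1))%:R / 2) = _).
  by rewrite invfM mulrACA divff// mul1r.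
by rewrite mulrDr mulrCA divff// mulr1.
Qed.

Lemma F8_ge (R : realType) (k j : nat) : (1 <= j <= k)%N ->
  j%:R / (j%:R + (ceil2sqrt j)%:R + 1) <= F8 R k.
Proof.
move=> jk; rewrite F8E; apply: (le_bigmax_seq 0 j xpredT (fun j : nat => j%:R / (j%:R + (ceil2sqrt j)%:R + 1))) => //.
by rewrite mem_index_iota.
Qed.

Lemma F4_ge (R : realType) (k j : nat) : (1 <= j <= k)%N ->
  (2 * j)%:R / (2 * j + ceil2sqrt (2 * j - 1))%:R <= F4 R k.
Proof.
move=> jk; rewrite F4E.
apply: (le_bigmax_seq 0 j xpredT (fun j : nat => (2 * j)%:R / (2 * j + ceil2sqrt (2 * j - 1))%:R)) => //.
by rewrite mem_index_iota.
Qed.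

Lemma F8_le (R : realType) (k : nat) (x : R) : 0 <= x ->
  (forall j, (1 <= j <= k)%N -> j%:R / (j%:R + (ceil2sqrt j)%:R + 1) <= x) -> F8 R k <= x.
Proof.
move=> x0 H; rewrite F8E big_nat_cond; apply: bigmax_le => // j /andP[jk _]; exact: H.
Qed.

Lemma F4_le (R : realType) (k : nat) (x : R) : 0 <= x ->
  (forall j, (1 <= j <= k)%N -> (2 * j)%:R / (2 * j + ceil2sqrt (2 * j - 1))%:R <= x) ->
  F4 R k <= x.
Proof.
move=> x0 H; rewrite F4E big_nat_cond; apply: bigmax_le => // j /andP[jk _]; exact: H.
Qed.

Lemma F8_ge0 (R : realType) (k : nat) : 0 <= F8 R k.
Proof. by rewrite F8E bigmax_ge_id. Qed.

Lemma F4_ge0 (R : realType) (k : nat) : 0 <= F4 R k.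
Proof. by rewrite F4E bigmax_ge_id. Qed.

Lemma density_le1 (R : realType) (I : binary_image) : density R I <= 1.
Proof.
rewrite -[leRHS]subr0; apply: (@density_le R I 0) => // m.
rewrite mul0r addr0 mul1r addn0 -natrX ler_nat white_countE -size_box -sum1_size.
by apply: leq_sum => z _; case: (I z).
Qed.

Lemma black_image_components (d : pixel -> pixel -> nat) k :
  white_components_size_le d k (fun=> false).
Proof. by move=> C [[z zC] CC _]; have [p [_ _]] := CC _ _ zC zC. Qed.

Lemma Phi_le (R : realType) (d : pixel -> pixel -> nat) k (x : R) :
  (forall I, white_components_size_le d k I -> density R I <= x) -> Phi R d k <= x.
Proof.
move=> H; apply: ge_sup; last by move=> _ [I Ik <-]; exact: H.
exists (density R (fun=> false)), (fun=> false) => //.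
exact: black_image_components.
Qed.

Lemma Phi_ge (R : realType) (d : pixel -> pixel -> nat) k I :
  white_components_size_le d k I ->
  density R I <= Phi R d k.
Proof.
move=> Ik; apply: ub_le_sup; last by exists I.
by exists 1 => _ [J _ <-]; exact: density_le1.
Qed.

Lemma is_repW (d : pixel -> pixel -> nat) (I : binary_image) r : is_rep d I r -> I r.
Proof. by case/andP. Qed.

Lemma wcomp_gt0 (d : pixel -> pixel -> nat) k (I : binary_image) z :
  (forall a b, d a b = d b a) ->
  white_components_size_le d k I -> I z -> (0 < #|` wcomp d I z|)%N.
Proof.
move=> dC Ik Iz; rewrite cardfs_gt0; apply/fset0Pn; exists z.
by apply/(compP _ _ _ _ _ dC Ik Iz); exact: white_connected_refl.
Qed.

(** By [card_square_hull] each component has at most [F8 R k] pixels per window it meets, and these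
    window sets are disjoint. *)
Lemma Phi8_le (R : realType) k : Phi R d8 k <= F8 R k.
Proof.
apply: Phi_le => I Ik; rewrite -[leRHS]subr0.
(* The radius grows by [k] to reach representatives and by [k + 1] to reach the windows of their
   components, so the side grows by [4 * k + 2]. *)
apply: (@density_le R I (4 * k + 2)); first exact: F8_ge0.
move=> m; rewrite mul0r addr0 white_countE.
apply: (@le_trans _ _ (\sum_(r <- box (m + k) | is_rep d8 I r) #|` wcomp d8 I r|)%N%:R).
  rewrite ler_nat; exact: sum_white_le d8C adj8_d8 Ik.
rewrite natr_sum.
apply: (@le_trans _ _ (\sum_(r <- box (m + k) | is_rep d8 I r)
   F8 R k * #|` square_hull (wcomp d8 I r)|%:R)).
  apply: ler_sum => r /is_repW Ir.
  have c0 := wcomp_gt0 _ _ _ _ d8C Ik Ir.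
  have ck := card_comp _ _ _ _ d8C Ik Ir.
  set A := wcomp d8 I r in c0 ck *.
  have := @F8_ge R k #|` A|; rewrite c0 ck => /(_ isT).
  rewrite ler_pdivrMr; last by rewrite -addrA addr_gt0// ?ltr0n// ltr_pwDr.
  move=> /le_trans; apply; rewrite ler_wpM2l ?F8_ge0//.
  have -> : #|` A|%:R + (ceil2sqrt #|` A|)%:R + 1 = (#|` A| + ceil2sqrt #|` A| + 1)%:R :> R.
    by rewrite !natrD.
  rewrite ler_nat.
  by apply: card_square_hull; rewrite -cardfs_gt0.
rewrite -mulr_sumr ler_wpM2l ?F8_ge0// -natr_sum -natrX ler_nat.
apply: leq_trans (sum_square_hull k I (m + k) Ik) _.
by rewrite size_box leq_sqr; lia.
Qed.

(** Same count with [touch4]; a window now carries up to two incidences, whence the weight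
    [F4 R k / 2]. *)
Lemma Phi4_le (R : realType) k : Phi R d4 k <= F4 R k.
Proof.
apply: Phi_le => I Ik; rewrite -[leRHS]subr0.
apply: (@density_le R I (4 * k + 2)); first exact: F4_ge0.
move=> m; rewrite mul0r addr0 white_countE.
apply: (@le_trans _ _ (\sum_(r <- box (m + k) | is_rep d4 I r) #|` wcomp d4 I r|)%N%:R).
  rewrite ler_nat; exact: sum_white_le d4C adj4_d8 Ik.
rewrite natr_sum.
apply: (@le_trans _ _ (\sum_(r <- box (m + k) | is_rep d4 I r)
   F4 R k / 2 * (touch4 (wcomp d4 I r))%:R)).
  apply: ler_sum => r /is_repW Ir.
  have c0 := wcomp_gt0 _ _ _ _ d4C Ik Ir.
  have ck := card_comp _ _ _ _ d4C Ik Ir.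
  have tA := touch4_ge _ _ _ Ik Ir.
  set A := wcomp d4 I r in c0 ck tA *.
  have := @F4_ge R k #|` A|; rewrite c0 ck => /(_ isT).
  rewrite ler_pdivrMr; last by rewrite ltr0n; lia.
  rewrite natrM mulrC -ler_pdivlMr// mulrAC => /le_trans; apply.
  by rewrite ler_wpM2l ?ler_nat// divr_ge0// F4_ge0.
rewrite -mulr_sumr -mulrA ler_wpM2l ?F4_ge0// -natr_sum mulrC ler_pdivrMr//.
rewrite -natrX -natrM ler_nat mulnC.
have := sum_diag_hulls k I (m + k) Ik.
move=> /(leq_trans (leq_addr _ _)) /leq_trans; apply.
by rewrite size_box leq_mul2l /= leq_sqr; lia.
Qed.

(** * Strict inequality from unavoidable local waste *)

Lemma white_components_size_leW (d : pixel -> pixel -> nat) (k K : nat) I :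
  (k <= K)%N -> white_components_size_le d k I -> white_components_size_le d K I.
Proof. by move=> kK Ik C /Ik /card_le_trans; apply; rewrite card_le_II. Qed.

Lemma sum_near_le (K m : nat) (r : int * int) :
  (\sum_(z <- box m) (d8 r z <= K) <= size (box K))%N.
Proof.
rewrite -big_mkcond sum1_count -size_filter.
have inj : injective (fun z : int * int => (z.1 - r.1, z.2 - r.2)).
  by move=> [x y] [x' y'] /= [/addIr -> /addIr ->].
rewrite -(size_map (fun z : int * int => (z.1 - r.1, z.2 - r.2))).
apply: uniq_leq_size.
  by rewrite map_inj_uniq// filter_uniq// uniq_box.
move=> _ /mapP[z + ->]; rewrite mem_filter => /andP[+ _].
by rewrite mem_box /d8 /=; lia.
Qed.

(* [js] is an optimal component size and [gs] its [ceil2sqrt (2 * js - 1)]. The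
   waste found near each pixel is counted at most [size (box K)] times. *)
Lemma density_lt_of_waste (R : realType) k (I : binary_image) (js gs K : nat) :
  (1 <= js)%N -> (k <= K)%N ->
  white_components_size_le d4 k I ->
  (forall j, (1 <= j <= k)%N -> (j * gs <= js * ceil2sqrt (2 * j - 1))%N) ->
  (forall z, (exists2 w, (d8 w z <= K)%N & (window_count I w <= 1)%N) \/
     exists r, [/\ is_rep d4 I r, (d8 r z <= K)%N &
       ((2 * js + gs) * #|` wcomp d4 I r| < js * touch4 (wcomp d4 I r))%N]) ->
  density R I <= (2 * js)%:R / (2 * js + gs)%:R
    - 1 / (size (box K) * (2 * js + gs))%:R.
Proof.
move=> js1 kK Ik opt waste; have IK := white_components_size_leW _ _ _ _ kK Ik.
set A := (2 * js + gs)%N; set Q := size (box K).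
have A0 : (0 < A)%N by rewrite /A; lia.
have Q0 : (0 < Q)%N by rewrite /Q size_box.
have key m : (Q * A * \sum_(z <- box m) I z + size (box m) <=
    2 * js * Q * size (box (m + K + K + 1)))%N.
  set M := (m + K)%N.
  pose bad r := (A * #|` wcomp d4 I r| < js * touch4 (wcomp d4 I r))%N.
  have h1 : (\sum_(z <- box m) I z <= \sum_(r <- box M | is_rep d4 I r) #|` wcomp d4 I r|)%N.
    exact: sum_white_le d4C adj4_d8 IK.
  have h2 := sum_diag_hulls K I M IK.
  rewrite -/(touch4 _) in h2.
  (* All quantities are integers, so each bad component accounts for at least one unit of waste. *)
  have h3 : (A * \sum_(r <- box M | is_rep d4 I r) #|` wcomp d4 I r| +
      \sum_(r <- box M | is_rep d4 I r) bad r <=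
      js * \sum_(r <- box M | is_rep d4 I r) touch4 (wcomp d4 I r))%N.
    rewrite !big_distrr -big_split /=; apply: leq_sum => r /is_repW Ir.
    rewrite /bad; set C := wcomp d4 I r.
    have c0 := wcomp_gt0 _ _ _ _ d4C Ik Ir.
    have ck := card_comp _ _ _ _ d4C Ik Ir.
    have tA := touch4_ge _ _ _ Ik Ir.
    have := opt #|` C|; rewrite c0 ck => /(_ isT) oC.
    have : (A * #|` C| <= js * touch4 C)%N.
      apply: (@leq_trans (js * (2 * #|` C| + ceil2sqrt (2 * #|` C| - 1)))%N).
        by rewrite /A mulnDl mulnDr [(gs * _)%N]mulnC; lia.
      by rewrite leq_mul2l tA orbT.
    by case: (ltnP (A * #|` C|) (js * touch4 C)) => /=; lia.
  (* Each pixel is charged to some waste within distance [K], and one unit of waste receives at most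
     [Q] charges. *)
  have h4 : (size (box m) <= Q * (\sum_(r <- box M | is_rep d4 I r) bad r +
      \sum_(w <- box (M + K + 1)) (window_count I w <= 1)))%N.
    rewrite -sum1_size.
    apply: (@leq_trans (\sum_(z <- box m)
      (\sum_(r <- box M | is_rep d4 I r) bad r * (d8 r z <= K) +
       \sum_(w <- box (M + K + 1)) (window_count I w <= 1) * (d8 w z <= K)))%N).
      rewrite big_seq [leqRHS]big_seq; apply: leq_sum => z zm.
      case: (waste z) => [[w wz ww]|[r [rr rz rw]]].
        have wM : w \in box (M + K + 1).
          by move: zm wz; rewrite !mem_box /d8 /M; lia.
        rewrite [X in (_ + X)%N](bigD1_seq w) ?uniq_box//= ww wz; lia.
      have rM : r \in box M by move: zm rz; rewrite !mem_box /d8 /M; lia.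
      rewrite -big_filter (bigD1_seq r) ?filter_uniq ?uniq_box ?mem_filter ?rr ?rM//=.
      by rewrite /bad rw rz; lia.
    rewrite big_split /= mulnDr; apply: leq_add.
      rewrite exchange_big big_distrr /=; apply: leq_sum => r _.
      by rewrite -big_distrr /= mulnC leq_mul2r sum_near_le orbT.
    rewrite exchange_big big_distrr /=; apply: leq_sum => r _.
    by rewrite -big_distrr /= mulnC leq_mul2r sum_near_le orbT.
  rewrite -/M; move: h1 h2 h3 h4.
  set W := (\sum_(z <- box m) I z)%N; set S1 := (\sum_(r <- _ | _) #|` _|)%N.
  set S2 := (\sum_(r <- _ | _) touch4 _)%N; set S3 := (\sum_(r <- _ | _) bad _)%N.
  set S4 := (\sum_(w <- _) _)%N; set B := size _; set B' := size _.
  move=> h1 h2 h3 h4.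
  have h5 : (A * W + (S3 + S4) <= 2 * js * B)%N.
    have : (A * W <= A * S1)%N by rewrite leq_mul2l h1 orbT.
    have : (S4 <= js * S4)%N by rewrite leq_pmull.
    have : (js * (S2 + S4) <= js * (2 * B))%N by rewrite leq_mul2l h2 orbT.
    by rewrite mulnDr; lia.
  have : (Q * (A * W + (S3 + S4)) <= Q * (2 * js * B))%N by rewrite leq_mul2l h5 orbT.
  by rewrite mulnDr; lia.
apply: (@density_le R I (4 * K + 2)); first by rewrite divr_ge0.
move=> m; rewrite white_countE.
have QA0 : (0 : R) < (Q * A)%:R by rewrite ltr0n muln_gt0 Q0.
rewrite -(ler_pM2l QA0) mulrDr mulrA mul1r mulfV ?gt_eqF// mul1r.
have -> : (Q * A)%:R * ((2 * js)%:R / A%:R * (m.*2.+1 + (4 * K + 2))%:R ^+ 2) =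
   (2 * js * Q * (m.*2.+1 + (4 * K + 2)) ^ 2)%:R :> R.
  have A1 : A%:R != 0 :> R by rewrite pnatr_eq0 -lt0n.
  by rewrite !(natrM, natrX); field.
rewrite -natrX -natrM -natrD ler_nat.
have := key m; rewrite !size_box => /leq_trans; apply.
by rewrite leq_mul2l leq_sqr; apply/orP; right; lia.
Qed.

Lemma odd_perimeter_opt (c js j s : nat) : (2 <= c)%N -> (2 * js = c * c.+1)%N ->
  (1 <= j)%N -> (4 * j <= 4 * js + c)%N -> (4 * (2 * j - 1) <= s ^ 2)%N ->
  (j * c.*2.+1 <= js * s)%N /\ ((js * s <= j * c.*2.+1)%N -> j = js).
Proof.
move=> c2 jsE j1 jk js2; have s2 : (8 * j <= s * s + 4)%N by rewrite mulnn; lia.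
have {js2} s_ge2 : (2 <= s)%N by rewrite leqNgt; apply/negP => h; nia.
case: (leqP s c.*2) => [sc|]; last first.
  rewrite leq_eqVlt => /predU1P[sE|sc].
    have jjs : (j <= js)%N by rewrite -sE in s2; nia.
    rewrite -sE leq_mul2r jjs orbT; split=> //.
    by rewrite leq_mul2r => jsj; apply/eqP; rewrite eqn_leq jjs.
  have h1 : (4 * j * c.*2.+1 <= (4 * js + c) * c.*2.+1)%N by rewrite leq_mul2r jk orbT.
  have h2 : (4 * js * c.*2.+2 <= 4 * js * s)%N by rewrite leq_mul2l sc orbT.
  (* Since [4 * js = 2 * c * (c + 1)], this is [c * (2 * c + 1) < 2 * c * (c + 1)]; here the excess
     of [j] over [js] is limited to [c / 4]. *)
  have h3 : ((4 * js + c) * c.*2.+1 < 4 * js * c.*2.+2)%N.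
    have -> : (4 * js = 2 * (c * c.+1))%N by lia.
    nia.
  have h4 : (j * c.*2.+1 < js * s)%N by lia.
  by split; [exact: ltnW|rewrite leqNgt h4].
suff h4 : (j * c.*2.+1 < js * s)%N by split; [exact: ltnW|rewrite leqNgt h4].
case: (leqP 3 c) => c3; last first.
  have c2' : c = 2%N by lia.
  subst c; have js3 : js = 3%N by lia.
  subst js; have : (s <= 4)%N by lia.
  case: s s2 s_ge2 {sc} => [|[|[|[|[|]]]]]//= s2 _ _; lia.
(* This is [(s - 2) * (s - 2 * c) <= 0]. *)
have h1 : (s * s + 4 * c <= (2 + c.*2) * s)%N.
  have [e eE] : exists e, c.*2 = (s + e)%N by exists (c.*2 - s)%N; lia.
  have [f fE] : exists f, s = (2 + f)%N by exists (s - 2)%N; lia.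
  nia.
have h2 : (8 * j * c.*2.+1 <= (s * s + 4) * c.*2.+1)%N by rewrite leq_mul2r s2 orbT.
have h3 : ((s * s + 4 * c) * c.*2.+1 <= (2 + c.*2) * s * c.*2.+1)%N by rewrite leq_mul2r h1 orbT.
have h5 : ((2 * (c.+1)) * s <= 2 * c.+1 * c.*2)%N by rewrite leq_mul2l sc orbT.
have h6 : (8 * (js * s) = 4 * (c * c.+1) * s)%N by rewrite -jsE; lia.
nia.
Qed.

Lemma Phi4_lt (R : realType) (k c js : nat) : (2 <= c)%N -> (2 * js = c * c.+1)%N ->
  (js <= k)%N -> (4 * k <= 4 * js + c)%N -> Phi R d4 k < F4 R k.
Proof.
move=> c2 jsE jsk kjs.
have js1 : (1 <= js)%N by nia.
have opt j : (1 <= j <= k)%N -> (j * c.*2.+1 <= js * ceil2sqrt (2 * j - 1))%N /\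
    ((js * ceil2sqrt (2 * j - 1) <= j * c.*2.+1)%N -> j = js).
  move=> /andP[j1 jk]; apply: odd_perimeter_opt => //; last exact: ceil2sqrt_ge.
  by lia.
(* The radius of the excluded patch, plus [k] to reach representatives. *)
pose K := (3 * c + 8 + k)%N.
pose A := (2 * js + c.*2.+1)%N.
apply: (@le_lt_trans _ _ ((2 * js)%:R / A%:R - 1 / (size (box K) * A)%:R)).
  apply: Phi_le => I Ik; apply: (@density_lt_of_waste R k) => //; first by rewrite /K; lia.
    by move=> j /opt[].
  (* Without waste near [z], every component near [z] attains equality, so it has size [js] and
     fills a [c] by [c + 1] box, which [no_perfect_patch] rules out. *)
  move=> z; apply: contrapT => /not_orP[nw nr].
  apply: (@no_perfect_patch k I c z) => //.
    move=> w wz; rewrite leqNgt; apply/negP => ww; apply: nw; exists w => //.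
    by rewrite /K; lia.
  move=> y Iy yz; pose r := rep d4 I y.
  have rr : is_rep d4 I r by exact: is_rep_rep d4C Iy.
  have rz : (d8 r z <= K)%N.
    have := comp_dist _ _ _ _ _ d4C adj4_d8 Ik (rep_connected d4 I y Iy).
    by rewrite -/r; move: yz; rewrite /K /d8; lia.
  have cr : wcomp d4 I r = wcomp d4 I y by exact: comp_rep d4C Iy.
  have : (js * touch4 (wcomp d4 I y) <= A * #|` wcomp d4 I y|)%N.
    by rewrite leqNgt; apply/negP => h; apply: nr; exists r; split=> //; rewrite cr.
  have c0 := wcomp_gt0 _ _ _ _ d4C Ik Iy.
  have ck := card_comp _ _ _ _ d4C Ik Iy.
  have tA := touch4_ge _ _ _ Ik Iy.
  have := @touch4_perfect k I y c c2 Ik Iy.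
  have := opt #|` wcomp d4 I y|; rewrite c0 ck => /(_ isT).
  move: tA; move: (wcomp d4 I y) => C tA [optC optCE] perf tC.
  have h1 : (js * (2 * #|` C| + ceil2sqrt (2 * #|` C| - 1)) <= js * touch4 C)%N.
    by rewrite leq_mul2l tA orbT.
  have CE : #|` C| = js.
    apply: optCE; move: h1 tC; rewrite /A mulnDl mulnDr [(_.+1 * _)%N]mulnC; lia.
  apply: perf; rewrite CE //.
  by move: tC; rewrite CE mulnC leq_pmul2r.
have A0 : (0 < A)%N by rewrite /A; lia.
apply: (@lt_le_trans _ _ ((2 * js)%:R / A%:R)).
  by rewrite ltrBlDr ltrDl divr_gt0// ltr0n muln_gt0 A0 size_box.
apply: le_trans (@F4_ge R k js _); last by rewrite js1.
rewrite ler_wpM2l// lef_pV2 ?posrE ?ltr0n//; last by lia.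
rewrite ler_nat leq_add2l; apply: ceil2sqrt_le; nia.
Qed.

(** * Periodic images *)

(** Double counting of pairs of a position and a shift: every translate of the pattern [S] has at
    least [n] white pixels, and each shifted box stays inside the box enlarged by [B]. *)
Lemma density_ge_shifts (R : realType) (I : binary_image) (S : seq (int * int)) (n : nat) :
  (0 < size S)%N ->
  (forall z, (n <= \sum_(s <- S) I (z.1 + s.1, z.2 + s.2)%R)%N) ->
  n%:R / (size S)%:R <= density R I.
Proof.
move=> S0 HS; have [B HB] : exists B, forall s, s \in S -> s \in box B.
  have [B HB] := fset_int2_bounded [fset s in S]%fset.
  by exists B => s sS; apply: HB; rewrite inE.
apply: (@density_ge R I B); first by rewrite divr_ge0.
move=> m; rewrite white_countE.
have H1 : (n * size (box m) <= size S * \sum_(z <- box (m + B)) I z)%N.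
  rewrite -sum1_size big_distrr.
  apply: (@leq_trans (\sum_(z <- box m) \sum_(s <- S) I (z.1 + s.1, z.2 + s.2)%R)%N).
    by apply: leq_sum => z _; rewrite /= muln1.
  rewrite exchange_big.
  have -> : (size S * \sum_(z <- box (m + B)) I z)%N =
      (\sum_(s <- S) \sum_(z <- box (m + B)) I z)%N.
    by rewrite [RHS]big_const_seq count_predT iter_addn_0 mulnC.
  rewrite big_seq [leqRHS]big_seq; apply: leq_sum => s sS.
  rewrite -[leqLHS]big_mkcond -[leqRHS]big_mkcond !sum1_count -!size_filter.
  rewrite -(size_map (fun z : int * int => (z.1 + s.1, z.2 + s.2)%R)).
  apply: uniq_leq_size.
    rewrite map_inj_uniq; first by rewrite filter_uniq// uniq_box.
    by move=> [x y] [x' y'] /= [/addIr -> /addIr ->].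
  move=> _ /mapP[z + ->]; rewrite !mem_filter => /andP[-> zm] /=.
  by move: (HB s sS) zm; rewrite !mem_box /=; lia.
rewrite mulrAC ler_pdivrMr ?ltr0n// -natrX -!natrM ler_nat [X in (_ <= X)%N]mulnC.
by rewrite size_box in H1.
Qed.

Lemma sum_periodic (f : int -> nat) (D : nat) (x y : int) :
  (forall t, f (t + D%:Z) = f t) ->
  (\sum_(l < D) f (x + l%:Z)%R = \sum_(l < D) f (y + l%:Z)%R)%N.
Proof.
move=> fD; pose g t := (\sum_(l < D) f (t + Posz l)%R)%N.
have gS t : g (t + 1) = g t.
  apply/eqP; rewrite -(eqn_add2l (f t)); apply/eqP.
  transitivity (\sum_(l < D.+1) f (t + Posz l)%R)%N.
    rewrite big_ord_recl addr0; congr (_ + _)%N; apply: eq_bigr => l _.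
    by congr f; rewrite lift0 -add1n PoszD addrA.
  by rewrite big_ord_recr /= fD addnC.
have gn (n : nat) t : g (t + n%:Z) = g t.
  by elim: n => [|n IH]; rewrite ?addr0// -addn1 PoszD addrA gS.
rewrite -/(g x) -/(g y); case: (lerP x y) => xy.
  by rewrite -(gn `|(y - x)%R|%N x); congr g; lia.
by rewrite -(gn `|(x - y)%R|%N y); congr g; lia.
Qed.

Lemma sum_periodic_rev (f : int -> nat) (D : nat) (x y : int) :
  (forall t, f (t + D%:Z) = f t) ->
  (\sum_(l < D) f (x - l%:Z)%R = \sum_(l < D) f (y + l%:Z)%R)%N.
Proof.
move=> fD; rewrite -(sum_periodic f D (x - D%:Z + 1) y fD).
rewrite (reindex_inj rev_ord_inj) /=; apply: eq_bigr => l _; congr f.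
by have := ltn_ord l; lia.
Qed.

Lemma size_le_sum_ord (P : pred nat) (D : nat) (s : seq nat) :
  uniq s -> (forall l, l \in s -> (l < D)%N && P l) ->
  (size s <= \sum_(l < D) P l)%N.
Proof.
move=> us sP; rewrite -(big_mkord xpredT (fun l => nat_of_bool (P l))) -big_mkcond /= sum1_count -size_filter.
apply: uniq_leq_size => // l /sP /andP[lD Pl].
by rewrite mem_filter Pl mem_index_iota.
Qed.

Lemma dvdz_small (D : nat) (x m : int) : x = m * D%:Z -> (`|x| < D)%N -> x = 0.
Proof.
move=> -> ; case: (eqVneq m 0) => [->|m0]; first by rewrite mul0r.
rewrite abszM absz_nat => h.
have : (1 <= `|m|)%N by lia.
nia.
Qed.

(** [anchor] is constant on components, so [code] injects each component into one list. In the
    applications [anchor] locates the tile and [code] the pixel within it. *)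
Lemma white_components_size_le_label (d : pixel -> pixel -> nat) k (I : binary_image)
    (T T' : eqType) (anchor : pixel -> T) (code : pixel -> T') (L : T -> seq T') :
  (forall x y, I x -> I y -> Defs.adjacent d x y -> anchor x = anchor y) ->
  (forall x y, I x -> I y -> anchor x = anchor y -> code x = code y -> x = y) ->
  (forall x, I x -> code x \in L (anchor x)) ->
  (forall x, I x -> size (L (anchor x)) <= k)%N ->
  white_components_size_le d k I.
Proof.
move=> adj codeI codeL Lk C [[z zC] CC _].
have conn x y : white_connected d I x y -> anchor x = anchor y.
  move=> [p [hp <- pI]]; elim: p x hp pI => [|t p IH] x //= /andP[xt hp] /and3P[Ix It pI].
  by rewrite (adj _ _ Ix It xt) IH//= It.
have CI x : C x -> I x.
  by move=> xC; have [] := white_connectedW _ _ _ _ (CC _ _ xC xC).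
have Ca x : C x -> anchor x = anchor z by move=> xC; apply: conn; exact: CC.
have [f fk finj] : exists2 f : pixel -> nat, set_fun C `I_k f & set_inj C f.
  exists (fun x => index (code x) (L (anchor z))).
    move=> x xC /=; apply: leq_trans (Lk z (CI z zC)).
    by rewrite index_mem -(Ca x xC); apply: codeL; exact: CI.
  move=> x y; rewrite !in_setE => xC yC E; apply: codeI; [exact: CI|exact: CI| |].
    by rewrite (Ca x xC) (Ca y yC).
  have cL t : C t -> code t \in L (anchor z).
    by move=> tC; rewrite -(Ca t tC); apply: codeL; exact: CI.
  by rewrite -(nth_index (code x) (cL x xC)) E nth_index// cL.
have [g] : $|{injfun C >-> `I_k}| by apply/injfunPex; exists f.
exact: inj_card_le g.
Qed.

(* The colour of (x, y) depends on [l = x + w y mod D]. The residues [0 <= l < D], read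
   in rows of length [w], form a tile of the plane; its last column is black, and so
   are the last [w + 1] residues. *)
Definition strip8 (w D : nat) (l : int) : bool :=
  ((l %% w%:Z)%Z + 1 != w%:Z) && (l + w%:Z + 1 < D%:Z).

Definition label8 (w D : nat) (z : pixel) : int := ((z.1 + w%:Z * z.2) %% D%:Z)%Z.

Definition image8 (w D : nat) : binary_image := fun z => strip8 w D (label8 w D z).

Lemma mod_decomp (x : int) (n : nat) : (0 < n)%N ->
  x = (x %/ n%:Z)%Z * n%:Z + (x %% n%:Z)%Z /\ 0 <= (x %% n%:Z)%Z < n%:Z.
Proof.
move=> n0; split; first exact: divz_eq.
by rewrite modz_ge0 ?ltz_pmod//; lia.
Qed.

Lemma image8_components (a b m : nat) : (1 <= m <= a)%N ->
  white_components_size_le d8 (a * b + m) (image8 a.+1 (a.+1 * b.+1 + m.+1)).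
Proof.
move=> ma; set w := a.+1; set D := (w * b.+1 + m.+1)%N.
have w0 : (0 < w)%N by [].
have D0 : (0 < D)%N by rewrite /D addnS.
pose lab := label8 w D.
apply: (@white_components_size_le_label _ _ _ _ _
  (* A label [q * w + r] sits in row [q] and column [r] of its tile, so subtracting them gives the
     tile origin. White residues below [w * b + m] fill [b] rows of [a] and a last one of [m]; the
     residue of rank [t] is [t + t %/ a], since each row skips one black entry. *)
  (fun z => (z.1 - (lab z %% w%:Z)%Z, z.2 - (lab z %/ w%:Z)%Z)) lab
  (fun=> [seq Posz (t + t %/ a) | t <- iota 0 (a * b + m)])).
- move=> x y; rewrite /image8 -!/(lab _) => /andP[xr xD] /andP[yr yD] xy.
  have [ex bx] := mod_decomp (x.1 + w%:Z * x.2) D D0.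
  have [ey by_] := mod_decomp (y.1 + w%:Z * y.2) D D0.
  rewrite -/(label8 w D x) -/(lab x) in ex bx; rewrite -/(label8 w D y) -/(lab y) in ey by_.
  have d1 : (`|(y.1 - x.1)%R| <= 1)%N by move: xy; rewrite /Defs.adjacent /d8; clear; lia.
  have d2 : (`|(y.2 - x.2)%R| <= 1)%N by move: xy; rewrite /Defs.adjacent /d8; clear; lia.
  (* The [w + 1] black residues at the end of a period exceed any label change between 8-neighbours
     that would wrap modulo [D]. *)
  have E : lab y - lab x - (y.1 - x.1) - w%:Z * (y.2 - x.2) = 0.
    apply: (@dvdz_small D _ (((x.1 + w%:Z * x.2) %/ D%:Z)%Z - ((y.1 + w%:Z * y.2) %/ D%:Z)%Z)).
      by rewrite mulrBl; move: ex ey; clear; lia.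
    have wd : (`|(w%:Z * (y.2 - x.2))%R| <= w)%N by rewrite abszM absz_nat; nia.
    move: wd xD yD bx by_ d1; clear; lia.
  have [hx rx] := mod_decomp (lab x) w w0.
  have [hy ry] := mod_decomp (lab y) w w0.
  move: xr yr hx hy rx ry E; set qx := (lab x %/ _)%Z; set qy := (lab y %/ _)%Z.
  set r1 := (lab x %% _)%Z; set r2 := (lab y %% _)%Z => xr yr hx hy rx ry E.
  (* The black last column likewise prevents wrapping modulo [w]. *)
  have E2 : r1 + (y.1 - x.1) - r2 = 0.
    apply: (@dvdz_small w _ (qy - qx - (y.2 - x.2))); last by move: d1 xr yr rx ry; clear; lia.
    by move: E hx hy; rewrite !mulrBl; clear; lia.
  have E3 : qy - qx - (y.2 - x.2) = 0.
    have /eqP : (qy - qx - (y.2 - x.2)) * w%:Z = 0.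
      by move: E hx hy E2; rewrite !mulrBl; clear; lia.
    by rewrite mulf_eq0 => /orP[/eqP //|]; rewrite eqz_nat.
  by congr (_, _); move: E2 E3; clear; lia.
- move=> [x1 x2] [y1 y2] _ _ /= [+ +] E; rewrite E => /addIr -> /addIr ->.
  by [].
- move=> x; rewrite /image8 -/(lab _) => /andP[xr xD].
  have [hx rx] := mod_decomp (lab x) w w0.
  move: xr hx rx; set q := (lab x %/ _)%Z; set r := (lab x %% _)%Z => xr hx rx.
  have l0 : 0 <= lab x by rewrite modz_ge0//; lia.
  have q0 : 0 <= q by rewrite /q divz_ge0.
  case: q q0 hx => // q _ hx.
  have [s rs] : exists s : nat, r = s by exists `|r|%N; move: rx; clear; lia.
  have sa : (s < a)%N by move: xr rx; rewrite rs /w; clear; lia.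
  apply/mapP; exists (q * a + s)%N; last first.
    rewrite divnMDl; last by move: sa; clear; lia.
    rewrite divn_small// addn0 hx rs /w; clear; lia.
  rewrite mem_iota add0n /=.
  have : (q * w + s < w * b + m)%N.
    by move: xD; rewrite hx rs /D mulnS; clear; lia.
  have : (q < b \/ q = b \/ b < q)%N by clear; lia.
  case=> [qb|[->|bq]].
  + have : (q.+1 * a <= b * a)%N by rewrite leq_mul2r qb orbT.
    by rewrite mulSn [(b * a)%N]mulnC; move: sa; clear; lia.
  + by rewrite [(w * b)%N]mulnC ltn_add2l [(b * a)%N]mulnC ltn_add2l.
  + have : (b.+1 * w <= q * w)%N by rewrite leq_mul2r bq orbT.
    by rewrite mulSn [(w * b)%N]mulnC; move: ma; rewrite /w; clear; lia.
- by move=> x _; rewrite size_map size_iota.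
Qed.

(** A horizontal run of [D] pixels takes every residue exactly once. *)
Lemma image8_density (R : realType) (a b m : nat) : (1 <= m <= a)%N ->
  (a * b + m)%:R / (a.+1 * b.+1 + m.+1)%:R <=
    density R (image8 a.+1 (a.+1 * b.+1 + m.+1)).
Proof.
move=> ma; set w := a.+1; set D := (w * b.+1 + m.+1)%N.
have D0 : (0 < D)%N by rewrite /D addnS.
pose S := [seq (Posz l, 0 : int) | l <- index_iota 0 D].
have sS : size S = D by rewrite size_map size_iota subn0.
rewrite -[X in _ / X%:R]sS; apply: density_ge_shifts; first by rewrite sS.
move=> z; rewrite big_map big_mkord.
pose f (t : int) := nat_of_bool (strip8 w D (t %% D%:Z)%Z).
have -> : (\sum_(l < D) image8 w D ((z.1 + Posz l)%R, (z.2 + 0)%R) =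
    \sum_(l < D) f (0 + Posz l)%R)%N.
  rewrite -(sum_periodic f D (z.1 + w%:Z * z.2) 0); last by move=> t; rewrite /f modzDr.
  apply: eq_bigr => l _; rewrite /f /image8 /label8 /= addr0; congr (nat_of_bool (strip8 _ _ (_ %% _)%Z)).
  by clear; lia.
have a0 : (0 < a)%N by move: ma; clear; lia.
pose L := [seq (t + t %/ a)%N | t <- iota 0 (a * b + m)].
rewrite (_ : (a * b + m)%N = size L); last by rewrite size_map size_iota.
apply: leq_trans (size_le_sum_ord (fun l => strip8 w D l) D L _ _) _.
- rewrite map_inj_in_uniq ?iota_uniq// => t t' _ _ E.
  by case: (ltngtP t t') => // h; have := leq_div2r a (ltnW h); move: E h; clear; lia.
- move=> _ /mapP[t + ->]; rewrite mem_iota add0n /= => tj.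
  have tE := divn_eq t a; have ra : (t %% a < a)%N by rewrite ltn_mod.
  set q := (t %/ a)%N in tE *; set r := (t %% a)%N in tE ra.
  have lE : (t + q = q * w + r)%N by rewrite {1}tE /w mulnS; clear; lia.
  have lt : (t + q + w + 1 < D)%N.
    have qb : (q <= b)%N.
      by rewrite -ltnS ltn_divLR// mulSn [(b * a)%N]mulnC; move: tj ma; clear; lia.
    by move: tj qb; rewrite /D /w mulSn !mulnS; clear; lia.
  apply/andP; split; first by move: lt; clear; lia.
  apply/andP; split; last by move: lt; clear; lia.
  rewrite lE modz_nat modnMDl modn_small; last by rewrite /w; move: ra; clear; lia.
  by move: ra; rewrite /w; clear; lia.
- by apply: leq_sum => l _; rewrite /f add0r modz_small//; have := ltn_ord l; lia.
Qed.

(** With [s = ceil2sqrt j], the sides [a] and [b + 1] split [s] as evenly as possible. Then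
    [a * (b + 1) >= j] gives [m <= a], and minimality of [s] gives [m >= 1]. *)
Lemma near_square_shape (j : nat) : (1 <= j)%N ->
  exists a b m, [/\ (1 <= m <= a)%N, j = (a * b + m)%N & ceil2sqrt j = (a + b + 1)%N].
Proof.
move=> j1; have h1 := ceil2sqrt_ge j; have h2 := @ceil2sqrt_lt j (ceil2sqrt j).-1.
have s2 : (2 <= ceil2sqrt j)%N by rewrite leqNgt; apply/negP => h; nia.
have {h2} h2 : ((ceil2sqrt j).-1 ^ 2 < 4 * j)%N by apply: h2; lia.
move: (ceil2sqrt j) h1 h2 s2 => s h1 h2 s2.
exists (uphalf s), (s./2).-1, (j - uphalf s * (s./2).-1)%N.
have := odd_double_half s; rewrite uphalf_half.
case: (odd s) => /= sE; move: (s./2) sE h1 h2 s2 => c <- h1 h2 s2.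
  have c1 : (1 <= c)%N by lia.
  case: c c1 h1 h2 s2 => // c _ h1 h2 s2 /=; split; lia || nia.
have c1 : (1 <= c)%N by lia.
case: c c1 h1 h2 s2 => // c _ h1 h2 s2 /=; split; lia || nia.
Qed.

Lemma Phi8_ge (R : realType) k : F8 R k <= Phi R d8 k.
Proof.
have Phi0 : 0 <= Phi R d8 k.
  apply: le_trans (Phi_ge R _ _ _ (black_image_components d8 k)).
  by apply: (@density_ge R _ 0) => // m; rewrite mul0r.
apply: F8_le => // j /andP[j1 jk].
have [a [b [m [ma jE sE]]]] := near_square_shape j j1.
apply: le_trans (@Phi_ge R d8 k (image8 a.+1 (a.+1 * b.+1 + m.+1)) _); last first.
  by apply: (@white_components_size_leW _ j) => //; rewrite jE; exact: image8_components.
apply: le_trans (image8_density R a b m ma); rewrite -jE.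
(* The period is [a * b + m + (a + b + 1) + 1], which is [j + ceil2sqrt j + 1]. *)
rewrite (_ : j%:R + (ceil2sqrt j)%:R + 1 = (a.+1 * b.+1 + m.+1)%:R)//.
by rewrite -natrD natr1 sE jE; congr _%:R; nia.
Qed.

(* Pixels are grouped in horizontal pairs with the same diagonal coordinates
   [U = ucoord], [V = vcoord], told apart by the parity [e]. The image depends only on
   [e] and on [l = w V - U mod D], [D = 2 w h - i], taken in [[i, i + D[]. A period holds
   two components, given by [l < w h] and [w h <= l]; removing the odd pixels with
   [D <= l] clips [i] pixels off a corner of each. *)
Definition strip4 (w h D : nat) (e : bool) (l : int) : bool :=
  if e then l < D%:Z
  else [&& (l %/ w%:Z)%Z != 0, (l %/ w%:Z)%Z != h%:Z & (l %% w%:Z)%Z + 1 != w%:Z].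

Definition odd4 (z : pixel) : bool := ((z.1 + z.2) %% 2)%Z == 1.
Definition ucoord (z : pixel) : int := ((z.1 + z.2) %/ 2)%Z.
Definition vcoord (z : pixel) : int := ((z.1 - z.2) %/ 2)%Z.

Definition label4 (w i D : nat) (z : pixel) : int :=
  i%:Z + ((w%:Z * vcoord z - ucoord z - i%:Z) %% D%:Z)%Z.

Definition image4 (w h i : nat) : binary_image := fun z =>
  strip4 w h (2 * (w * h) - i) (odd4 z) (label4 w i (2 * (w * h) - i) z).

(** The first summand counts the odd pixels of a component, the second its even pixels. *)
Definition size4 (w h i : nat) : nat := (w * h - i + (w - 1) * (h - 1))%N.

Lemma pixel_eq (x y : pixel) :
  odd4 x = odd4 y -> ucoord x = ucoord y -> vcoord x = vcoord y -> x = y.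
Proof.
case: x y => [x1 x2] [y1 y2]; rewrite /odd4 /ucoord /vcoord /= => h1 h2 h3.
by congr (_, _); lia.
Qed.

Lemma adjacent4_coord (x y : pixel) : Defs.adjacent d4 x y ->
  odd4 y = ~~ odd4 x /\ (odd4 x -> (ucoord y - ucoord x == 0) || (ucoord y - ucoord x == 1)) /\
  (odd4 x -> (vcoord y - vcoord x == 0) || (vcoord y - vcoord x == 1)).
Proof.
case: x y => [x1 x2] [y1 y2]; rewrite /Defs.adjacent /d4 /odd4 /ucoord /vcoord /= => h.
by split; [lia|split; lia].
Qed.

Lemma not_multiple (w : nat) (l m : int) : (0 < w)%N ->
  (l %% w%:Z)%Z + 1 != w%:Z -> l + 1 != m * w%:Z.
Proof.
move=> w0 h; have [hl rl] := mod_decomp l w w0; apply/eqP => E.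
suff : (l %% w%:Z)%Z + 1 = 0 by move: rl; clear; lia.
apply: (@dvdz_small w _ (m - (l %/ w%:Z)%Z)); last by move: rl h; clear; lia.
by rewrite mulrBl -E; move: hl; clear; lia.
Qed.

Lemma divz_unique (w : nat) (l m : int) : m * w%:Z <= l < (m + 1) * w%:Z ->
  (l %/ w%:Z)%Z = m.
Proof.
rewrite mulrDl mul1r => lm; have w0 : (0 < w)%N by move: lm; clear; lia.
have [hl rl] := mod_decomp l w w0.
suff : (l %/ w%:Z)%Z - m = 0 by lia.
have /eqP : ((l %/ w%:Z)%Z - m) * w%:Z = 0.
  apply: (@dvdz_small w _ ((l %/ w%:Z)%Z - m)) => //.
  by rewrite mulrBl; move: hl rl lm; clear; lia.
by rewrite mulf_eq0 => /orP[/eqP //|]; rewrite eqz_nat; move: w0; clear; lia.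
Qed.

(** The tile origin in the coordinates [-U], [V], together with the choice between the two
    components of a period. *)
Definition anchor4 (w h i : nat) (z : pixel) : int * int * bool :=
  let l := label4 w i (2 * (w * h) - i) z in
  (- ucoord z - (l %% w%:Z)%Z, vcoord z - (l %/ w%:Z)%Z, l < (w * h)%:Z).

Lemma label4_bounds (w i D : nat) z : (0 < D)%N ->
  i%:Z <= label4 w i D z < i%:Z + D%:Z.
Proof.
move=> D0; have [_ h] := mod_decomp (w%:Z * vcoord z - ucoord z - i%:Z) D D0.
by move: h; rewrite /label4; clear; lia.
Qed.

Lemma anchor4_adj (w h i : nat) (x y : pixel) :
  (1 <= w)%N -> (1 <= h)%N -> (i <= w)%N ->
  odd4 x -> image4 w h i x -> image4 w h i y -> Defs.adjacent d4 x y ->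
  anchor4 w h i x = anchor4 w h i y.
Proof.
move=> w1 h1 iw ox; rewrite /image4 /anchor4; set D := (2 * (w * h) - i)%N.
have wwh : (w <= w * h)%N by rewrite leq_pmulr.
have D0 : (0 < D)%N by rewrite /D; move: wwh w1 iw; clear; lia.
move=> + + /adjacent4_coord; rewrite ox => + + [oy [/(_ isT) du /(_ isT) dv]].
rewrite oy /= => xD /and3P[qy0 qyh ry].
have bx := label4_bounds w i D x D0; have by_ := label4_bounds w i D y D0.
have [ex _] := mod_decomp (w%:Z * vcoord x - ucoord x - i%:Z) D D0.
have [ey _] := mod_decomp (w%:Z * vcoord y - ucoord y - i%:Z) D D0.
set nx := (_ %/ D%:Z)%Z in ex; set ny := (_ %/ D%:Z)%Z in ey.
have {}ex : label4 w i D x = w%:Z * vcoord x - ucoord x - nx * D%:Z.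
  by move: ex; rewrite /label4; clear; lia.
have {}ey : label4 w i D y = w%:Z * vcoord y - ucoord y - ny * D%:Z.
  by move: ey; rewrite /label4; clear; lia.
move: ex ey xD qy0 qyh ry bx by_.
set lx := label4 w i D x; set ly := label4 w i D y => ex ey xD qy0 qyh ry bx by_.
have nm m := @not_multiple w ly m w1 ry.
have [hx rx] := mod_decomp lx w w1.
have [hy ry'] := mod_decomp ly w w1.
have lyw : w%:Z <= ly.
  rewrite leNgt; apply/negP => lyw; move/eqP: qy0; apply.
  by apply: divz_unique; rewrite mul0r add0r mul1r lyw andbT; move: by_; clear; lia.
pose du' := ucoord y - ucoord x; pose dv' := vcoord y - vcoord x.
have dwv : w%:Z * dv' = 0 \/ w%:Z * dv' = w%:Z.
  by case/orP: dv => /eqP; rewrite -/dv' => ->; [left; rewrite mulr0|right; rewrite mulr1].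
(* An even white [y] has [w <= ly < D + i - 1] and an odd white [x] has [i <= lx < D], so the label
   change cannot wrap modulo [D]. *)
have E : ly = lx + w%:Z * dv' - du'.
  suff : ly - lx - w%:Z * dv' + du' = 0 by clear; lia.
  apply: (@dvdz_small D _ (nx - ny)).
    by rewrite mulrBl /du' /dv' mulrBr; move: ex ey; clear; lia.
  have := nm (2 * h%:Z).
  have DE : D%:Z + i%:Z = 2 * h%:Z * w%:Z by rewrite /D; move: wwh iw; clear; lia.
  rewrite -DE; move: dwv du bx by_ xD lyw; rewrite -/du'; clear; lia.
(* Passing between the halves would put the even pixel [y] in the black row [h] or the black last
   column. *)
have side : (lx < (w * h)%:Z) = (ly < (w * h)%:Z).
  apply/idP/idP => hlt.
    rewrite ltNge; apply/negP => hge; move/eqP: qyh; apply; apply: divz_unique.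
    rewrite mulrDl mul1r; move: hlt hge E dwv du; rewrite -/du' PoszM [h%:Z * _]mulrC.
    by clear; lia.
  rewrite ltNge; apply/negP => hge; have := nm h%:Z.
  by move: hlt hge E dwv du; rewrite -/du' PoszM [h%:Z * _]mulrC; clear; lia.
move: hx rx hy ry' ry; set qx := (lx %/ _)%Z; set qy := (ly %/ _)%Z.
set r1 := (lx %% _)%Z; set r2 := (ly %% _)%Z => hx rx hy ry' ry.
have E2 : r1 - du' - r2 = 0.
  apply: (@dvdz_small w _ (qy - qx - dv')).
    by rewrite !mulrBl; move: E hx hy; clear; lia.
  by move: du rx ry' ry; rewrite -/du'; clear; lia.
have E3 : qy - qx - dv' = 0.
  have /eqP : (qy - qx - dv') * w%:Z = 0.
    by rewrite !mulrBl; move: E hx hy E2; clear; lia.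
  by rewrite mulf_eq0 => /orP[/eqP //|]; rewrite eqz_nat; move: w1; clear; lia.
by rewrite side; congr (_, _, _); move: E2 E3; rewrite /du' /dv'; clear; lia.
Qed.

Definition tile4 (w h i : nat) (side : bool) : seq (bool * int) :=
  [seq (true, Posz l) | l <- iota (if side then i else w * h) (w * h - i)] ++
  [seq (false, Posz (q * w + r)) | q <- iota (if side then 1 else h.+1) (h - 1),
     r <- iota 0 (w - 1)].

Lemma size_tile4 w h i side : size (tile4 w h i side) = size4 w h i.
Proof.
by rewrite size_cat size_map size_allpairs !size_iota /size4 [((h - 1) * _)%N]mulnC.
Qed.

Lemma image4_components (w h i : nat) :
  (1 <= w)%N -> (1 <= h)%N -> (i <= w)%N ->
  white_components_size_le d4 (size4 w h i) (image4 w h i).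
Proof.
move=> w1 h1 iw.
have wwh : (w <= w * h)%N by rewrite leq_pmulr.
pose lab := label4 w i (2 * (w * h) - i).
apply: (@white_components_size_le_label _ _ _ _ _ (anchor4 w h i)
  (fun z => (odd4 z, lab z)) (fun a => tile4 w h i a.2)).
- move=> x y Ix Iy xy; have [oy _] := adjacent4_coord _ _ xy.
  case ox: (odd4 x) oy => /= oy; first exact: anchor4_adj.
  by apply/esym; apply: anchor4_adj => //; move: xy; rewrite /Defs.adjacent d4C.
- move=> x y _ _ [+ + _] [oE lE]; rewrite -/(lab x) -/(lab y) lE => /addIr/oppr_inj uE /addIr vE.
  exact: pixel_eq.
- move=> x; rewrite /image4 -/(lab x) /=; set D := (2 * (w * h) - i)%N.
  have D0 : (0 < D)%N by rewrite /D; move: wwh w1 iw; clear; lia.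
  have := label4_bounds w i D x D0; rewrite -/(lab x) => lb.
  rewrite mem_cat; case: (odd4 x) => /=.
    move=> lD; apply/orP; left; apply/mapP; exists `|lab x|%N; last first.
      by congr (_, _); move: lb; clear; lia.
    by rewrite mem_iota; move: lb lD; rewrite /D; case: ifP; move: wwh iw; clear; lia.
  move=> /and3P[q0 qh rw]; apply/orP; right.
  have [hx rx] := mod_decomp (lab x) w w1.
  move: q0 qh rw hx rx; set q := (lab x %/ _)%Z; set r := (lab x %% _)%Z => q0 qh rw hx rx.
  have qge0 : 0 <= q by rewrite divz_ge0; move: lb w1; clear; lia.
  case: q qge0 hx q0 qh => // q _ hx q0 qh.
  have [s rs] : exists s : nat, r = s by exists `|r|%N; move: rx; clear; lia.
  have qD : (q < 2 * h)%N.
    have qlt : (q * w < 2 * h * w)%N.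
      have : (q * w + s < 2 * h * w)%N.
        by move: lb; rewrite hx rs /D; move: wwh iw; clear; lia.
      by clear; lia.
    by move: qlt; rewrite ltn_mul2r => /andP[].
  rewrite hx rs -PoszM -PoszD; apply: (allpairs_f (fun q r => (false, Posz (q * w + r)))).
    have sideE : (Posz (q * w + s) < (w * h)%:Z) = (q < h)%N.
      apply/idP/idP => hlt.
        rewrite ltnNge; apply/negP => hq.
        have : (h * w <= q * w)%N by rewrite leq_mul2r hq orbT.
        by rewrite [(h * w)%N]mulnC; move: hlt; clear; lia.
      have : (q.+1 * w <= h * w)%N by rewrite leq_mul2r hlt orbT.
      by rewrite [(h * w)%N]mulnC mulSn; move: rx rs; clear; lia.
    by rewrite sideE mem_iota; case: ifP; move: q0 qh qD; clear; lia.
  by rewrite mem_iota; move: rw rx rs; clear; lia.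
- by move=> x _; rewrite size_tile4.
Qed.

Lemma strip4_odd_count (w h i D : nat) :
  (D - i <= \sum_(l < D) strip4 w h D true (i%:Z + Posz l)%R)%N.
Proof.
rewrite -[leqLHS](size_iota 0).
apply: (size_le_sum_ord (fun l => strip4 w h D true (i%:Z + Posz l))); first exact: iota_uniq.
by move=> l; rewrite mem_iota /strip4; clear; lia.
Qed.

Lemma strip4_even_count (w h i D : nat) : (1 <= w)%N -> (i <= w)%N ->
  (D + i = 2 * (w * h))%N ->
  (2 * ((h - 1) * (w - 1)) <= \sum_(l < D) strip4 w h D false (i%:Z + Posz l)%R)%N.
Proof.
move=> w1 iw DE.
pose qs := iota 1 (h - 1) ++ iota h.+1 (h - 1).
have qsP q : q \in qs -> [/\ (1 <= q)%N, (q < 2 * h)%N & q <> h].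
  by rewrite mem_cat !mem_iota; clear; split; lia.
pose L := [seq (q * w + r - i)%N | q <- qs, r <- iota 0 (w - 1)].
have qrw q r : q \in qs -> r \in iota 0 (w - 1) ->
    [/\ (w <= q * w + r)%N, (q * w + r < 2 * h * w)%N & (r < w)%N].
  move=> /qsP [q1 q2 _]; rewrite mem_iota add0n => rw.
  have : (1 * w <= q * w)%N by rewrite leq_mul2r q1 orbT.
  have : (q.+1 * w <= 2 * h * w)%N by rewrite leq_mul2r q2 orbT.
  by rewrite mulSn; move: rw w1; clear; split; lia.
have -> : (2 * ((h - 1) * (w - 1)))%N = size L.
  by rewrite size_allpairs size_cat !size_iota addnn -mul2n mulnA.
apply: (size_le_sum_ord (fun l => strip4 w h D false (i%:Z + Posz l))).
- apply: allpairs_uniq.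
  + rewrite cat_uniq !iota_uniq andbT /= -all_predC; apply/allP => q.
    by rewrite mem_iota /= mem_iota; clear; lia.
  + exact: iota_uniq.
  + move=> [q r] [q' r'] /allpairsP[[a b] /= [aq br [-> ->]]].
    move=> /allpairsP[[a' b'] /= [aq' br' [-> ->]]] E.
    have [h1 _ h2] := qrw _ _ aq br; have [h3 _ h4] := qrw _ _ aq' br'.
    have {}E : (a * w + b = a' * w + b')%N by move: E h1 h3 iw; clear; lia.
    have := congr1 (divn^~ w) E; rewrite !divnMDl// !divn_small// !addn0 => aa.
    by move: E; rewrite aa => /addnI ->.
- move=> _ /allpairsP[[q r] /= [qq rr ->]].
  have [h1 h2 h3] := qrw _ _ qq rr; have [q1 q2 qh] := qsP _ qq.
  have -> : i%:Z + Posz (q * w + r - i) = Posz (q * w + r) by move: h1 iw; clear; lia.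
  rewrite divz_nat modz_nat divnMDl// divn_small// addn0 modnMDl modn_small//.
  move: rr; rewrite mem_iota add0n => rr.
  apply/andP; split; first by move: h1 h2 DE iw w1; clear; lia.
  by apply/and3P; split; move: q1 qh rr; clear; lia.
Qed.

(** Along a diagonal run of length [D] the parity is fixed and every label occurs once; two adjacent
    diagonals supply both parities, hence two components per [2 * D] pixels. *)
Lemma image4_density (R : realType) (w h i : nat) :
  (1 <= w)%N -> (1 <= h)%N -> (i <= w)%N ->
  (size4 w h i)%:R / (2 * (w * h) - i)%:R <= density R (image4 w h i).
Proof.
move=> w1 h1 iw; set D := (2 * (w * h) - i)%N.
have wwh : (w <= w * h)%N by rewrite leq_pmulr.
have D0 : (0 < D)%N by rewrite /D; move: wwh w1 iw; clear; lia.
pose S : seq (int * int) := [seq (Posz l, Posz l) | l <- index_iota 0 D] ++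
  [seq (Posz l + 1, Posz l) | l <- index_iota 0 D].
have sS : size S = (2 * D)%N by rewrite size_cat !size_map size_iota subn0 addnn -mul2n.
have -> : (size4 w h i)%:R / D%:R = (2 * size4 w h i)%:R / (size S)%:R :> R.
  rewrite sS !natrM; field.
  by rewrite pnatr_eq0 -lt0n D0.
apply: density_ge_shifts; first by rewrite sS; move: D0; clear; lia.
move=> z; rewrite big_cat !big_map !big_mkord.
pose f e (t : int) := nat_of_bool (strip4 w h D e (i%:Z + ((t - i%:Z) %% D%:Z)%Z)).
have fD e t : f e (t + D%:Z) = f e t.
  by rewrite /f (_ : t + D%:Z - i%:Z = t - i%:Z + D%:Z) ?modzDr //; clear; lia.
pose lz := w%:Z * vcoord z - ucoord z.
have -> : (\sum_(l < D) image4 w h i ((z.1 + Posz l)%R, (z.2 + Posz l)%R) =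
    \sum_(l < D) f (odd4 z) (i%:Z + Posz l)%R)%N.
  rewrite -(sum_periodic_rev (f (odd4 z)) D lz)//; apply: eq_bigr => l _.
  rewrite /f /image4 /label4 /lz /odd4 /ucoord /vcoord /=.
  have -> : ((z.1 + Posz l + (z.2 + Posz l)) %% 2)%Z = ((z.1 + z.2) %% 2)%Z by clear; lia.
  have -> : ((z.1 + Posz l + (z.2 + Posz l)) %/ 2)%Z = ((z.1 + z.2) %/ 2)%Z + Posz l by clear; lia.
  have -> : ((z.1 + Posz l - (z.2 + Posz l)) %/ 2)%Z = ((z.1 - z.2) %/ 2)%Z by clear; lia.
  by congr (nat_of_bool (strip4 _ _ _ _ (_ + (_ %% _)%Z))); clear; lia.
have -> : (\sum_(l < D) image4 w h i ((z.1 + (Posz l + 1))%R, (z.2 + Posz l)%R) =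
    \sum_(l < D) f (~~ odd4 z) (i%:Z + Posz l)%R)%N.
  (* A step to the right raises both [U] and [V] by one from an odd pixel and neither from an even
     one, so the label is offset by [w - 1] or [0]. *)
  rewrite -(sum_periodic_rev (f (~~ odd4 z)) D (lz + if odd4 z then w%:Z - 1 else 0))//.
  apply: eq_bigr => l _.
  rewrite /f /image4 /label4 /lz /odd4 /ucoord /vcoord /=.
  have -> : (((z.1 + (Posz l + 1) + (z.2 + Posz l)) %% 2)%Z == 1) = ~~ (((z.1 + z.2) %% 2)%Z == 1).
    by clear; lia.
  have -> : ((z.1 + (Posz l + 1) + (z.2 + Posz l)) %/ 2)%Z = ((z.1 + z.2) %/ 2)%Z + Posz l +
     (((z.1 + z.2) %% 2)%Z == 1)%:Z by clear; lia.
  have -> : ((z.1 + (Posz l + 1) - (z.2 + Posz l)) %/ 2)%Z = ((z.1 - z.2) %/ 2)%Z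
     + (((z.1 + z.2) %% 2)%Z == 1)%:Z by clear; lia.
  congr (nat_of_bool (strip4 _ _ _ _ (_ + (_ %% _)%Z))).
  by case: ifP => _ /=; clear; lia.
have fE e : (\sum_(l < D) f e (i%:Z + Posz l)%R = \sum_(l < D) strip4 w h D e (i%:Z + Posz l)%R)%N.
  apply: eq_bigr => l _; rewrite /f addrAC subrr add0r modz_small//.
  by have := ltn_ord l; clear; lia.
rewrite !fE.
have ce := strip4_even_count w h i D w1 iw; have co := strip4_odd_count w h i D.

have DE : (D + i = 2 * (w * h))%N by rewrite /D; move: wwh iw; clear; lia.
have {}ce := ce DE.
suff : (2 * size4 w h i <= \sum_(l < D) strip4 w h D true (i%:Z + Posz l)%R +
    \sum_(l < D) strip4 w h D false (i%:Z + Posz l)%R)%N.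
  by case: (odd4 z) => //=; rewrite addnC.
apply: leq_trans (leq_add co ce); rewrite /size4 [((h - 1) * _)%N]mulnC.
by move: DE wwh iw; clear; lia.
Qed.

(** [M] is the capacity of a [c] by [c] rotated box, of perimeter [2 * c]. For [k] close to [M] the
    best ratio of size to perimeter is that of the largest admissible size [j0] in such a box. *)
Lemma even_perimeter_opt (c M j0 k j s : nat) : (1 <= c)%N ->
  M = (c * c + 1)./2 -> j0 = minn k M ->
  (4 * k <= 4 * M + c - odd c)%N -> (4 * M <= 4 * k + c + odd c)%N ->
  (1 <= j <= k)%N -> (4 * (2 * j - 1) <= s ^ 2)%N ->
  (j * c.*2 <= j0 * s)%N.
Proof.
move=> c1 ME j0E kM Mk jk js2.
have M2 : (2 * M = c * c + odd c)%N.
  have := odd_double_half (c * c + 1); rewrite -ME oddD oddM /=.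
  by case: (odd c) => /=; clear; lia.
have s2 : (8 * j <= s * s + 4)%N by rewrite mulnn; move: js2; clear; lia.
have s_ge2 : (2 <= s)%N by rewrite leqNgt; apply/negP => h; move: jk s2; clear -h; nia.
have j04 : (2 * (c * c) <= 4 * j0 + c)%N.
  rewrite j0E; case: (leqP k M) => _; move: M2 Mk; case: (odd c); clear; lia.
have parity (x : nat) : (2 * x <= c * c - c + 1)%N -> (2 * x <= c * c - c)%N.
  have : ~~ odd (c * c - c) by rewrite oddB ?leq_pmulr// oddM andbb addbb.
  by clear; lia.
case: (ltngtP s c.*2) => sc.
- case: (leqP s (c.*2 - 2)) => sc2.
    case: (leqP 3 c) => c3; last first.
      have c2 : c = 2%N by move: s_ge2 sc2 c3 c1; clear; lia.
      have s2' : s = 2%N by move: s_ge2 sc2; rewrite c2; clear; lia.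
      by move: s2 j04; rewrite c2 s2'; clear; lia.
    have h1 : (8 * j * c <= (s * s + 4) * c)%N by rewrite leq_mul2r s2 orbT.
    have h2 : (s * s + 4 + s <= c.*2 * s)%N.
      have [e eE] : exists e, c.*2 = (s + e + 2)%N.
        by exists (c.*2 - 2 - s)%N; move: sc2 sc; clear; lia.
      have [f fE] : exists f, s = (2 + f)%N by exists (s - 2)%N; move: s_ge2; clear; lia.
      have ef : (2 <= e + f)%N by move: eE fE c3; clear; lia.
      by rewrite eE fE; move: ef; clear; nia.
    have h3 : ((s * s + 4 + s) * c <= c.*2 * s * c)%N by rewrite leq_mul2r h2 orbT.
    have h4 : (2 * (c * c) * s <= (4 * j0 + c) * s)%N by rewrite leq_mul2r j04 orbT.
    by move: h1 h3 h4; clear; lia.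
  (* For [s = 2 * c - 1] the capacity alone is too weak by one; the evenness of [c * c - c] closes
     the gap. *)
  have sE : s = (c.*2 - 1)%N by move: sc sc2; clear; lia.
  have h1 : (2 * j <= c * c - c + 1)%N.
    move: s2; rewrite sE; have [d ->] : exists d, c = d.+1 by exists c.-1; move: c1; clear; lia.
    by clear; nia.
  have h2 : (2 * j * c <= (c * c - c) * c)%N by rewrite leq_mul2r parity ?orbT.
  have h3 : (2 * (c * c) * s <= (4 * j0 + c) * s)%N by rewrite leq_mul2r j04 orbT.
  move: h2 h3; rewrite sE; have [d ->] : exists d, c = d.+1 by exists c.-1; move: c1; clear; lia.
  by clear; nia.
- have : (c.*2.+1 <= s)%N by [].
  move=> {}sc; have /andP[_ jk'] := jk.
  move: kM j0E; case: (leqP k M) => kM' kM j0E.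
    by rewrite j0E; apply: leq_mul => //; move: sc; clear; lia.
  have h1 : (M * c.*2.+1 <= M * s)%N by rewrite leq_mul2l sc orbT.
  have h2 : (4 * j * c <= (4 * M + c - odd c) * c)%N.
    by rewrite leq_mul2r (leq_trans _ kM) ?orbT// leq_mul2l.
  rewrite j0E; move: h1 h2 M2; case: (odd c); clear; nia.
- have jM : (j <= M)%N.
    have : (2 * j <= c * c + 1)%N by move: s2; rewrite sc; clear; nia.
    have : odd (c * c) = odd c by rewrite oddM andbb.
    by move: M2; clear; case: (odd c) => /=; lia.
  rewrite sc leq_mul2r; apply/orP; right; rewrite j0E leq_min jM andbT.
  by case/andP: jk.
Qed.

(** The image with [w + h = c + 1] and [w], [h] as equal as possible has components of size [M - i]
    and half-period [M + c - i] per component. Clipping [i = M - j0] pixels gives density at least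
    [j0 / (j0 + c)], the optimal value. *)
Lemma Phi4_eq (R : realType) (c M k : nat) : (1 <= c)%N -> (1 <= k)%N ->
  M = (c * c + 1)./2 ->
  (4 * k <= 4 * M + c - odd c)%N -> (4 * M <= 4 * k + c + odd c)%N ->
  Phi R d4 k = F4 R k.
Proof.
move=> c1 k1 ME kM Mk; apply/eqP; rewrite eq_le Phi4_le /=.
pose j0 := minn k M; pose i := (M - j0)%N.
pose w := (c.+1)./2; pose h := (c.+2)./2.
have j0M : (j0 <= M)%N by rewrite geq_minr.
have whE : (2 * (w * h) = M + c)%N.
  rewrite ME /w /h /= uphalf_half; have := odd_double_half c.
  case: (odd c) => /= <-; move: (c./2) => d; clear; nia.
have w1 : (1 <= w)%N by rewrite /w; move: c1; clear; lia.
have h1 : (1 <= h)%N by rewrite /h; move: c1; clear; lia.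
have wh : (w + h = c.+1)%N by rewrite /w /h; clear; lia.
have iw : (i <= w)%N.
  have : (4 * i <= c + odd c)%N.
    by rewrite /i /j0; case: (leqP k M) => _; move: Mk; clear; lia.
  by rewrite /w; clear; lia.
have sE : size4 w h i = j0.
  have : (w * h - i + (w - 1) * (h - 1) = M - i)%N.
    have iwh : (i <= w * h)%N by rewrite (leq_trans iw)// leq_pmulr.
    move: whE wh iwh w1 h1; clear.
    case: w => // w; case: h => // h; rewrite !subn1 /= => E1 E2 E3 _ _.
    by move: E1 E2 E3; rewrite mulSn mulnS; lia.
  by rewrite /size4 => ->; rewrite /i subKn.
have dE : (2 * (w * h) - i = j0 + c)%N by rewrite whE /i; move: j0M; clear; lia.
apply: (@le_trans _ _ (j0%:R / (j0 + c)%:R)); last first.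
  apply: le_trans (@Phi_ge R d4 k (image4 w h i) _).
    by have := image4_density R w h i w1 h1 iw; rewrite sE dE.
  apply: (@white_components_size_leW _ j0); first exact: geq_minl.
  by rewrite -sE; exact: image4_components.
apply: F4_le; first by rewrite divr_ge0.
move=> j jk; have := even_perimeter_opt c M j0 k j _ c1 ME erefl kM Mk jk (ceil2sqrt_ge _).
move: (ceil2sqrt _) => s H.
have j1 : (0 < j)%N by case/andP: jk.
rewrite ler_pdivrMr ?ltr0n ?addn_gt0 ?muln_gt0 ?j1// mulrAC.
rewrite ler_pdivlMr ?ltr0n; last by move: c1; clear; lia.
rewrite -!natrM ler_nat mulnDr [leqRHS]mulnDr; move: H; clear; lia.
Qed.

Theorem theorem1p1 (R : realType) :
  (forall k : nat, (1 <= k)%N ->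
     Phi R d8 k = F8 R k /\ Phi R d4 k <= F4 R k) /\
  (forall k : nat, calS k -> Phi R d4 k = F4 R k) /\
  (forall k : nat, calU k -> Phi R d4 k < F4 R k).
Proof.
split; [|split].
- move=> k _; split; last exact: Phi4_le.
  by apply/eqP; rewrite eq_le Phi8_le Phi8_ge.
- move=> k [k1 [[//|p] _]]; rewrite /s0 /s2.
  have -> : p.+1%:R = p%:R + 1 :> rat by rewrite natr1.
  case=> /andP[lo hi].
  + have {}lo : (2 * (p * p + p.+1 * p.+1) <= 2 * k + p.+1)%N.
      by rewrite -(ler_nat rat) !(natrD, natrM) -!natr1; nra.
    have {}hi : (2 * k <= 2 * (p * p + p.+1 * p.+1) + p)%N.
      by rewrite -(ler_nat rat) !(natrD, natrM) -!natr1; nra.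
    (* With [n = p + 1], the range around [s0 n] belongs to [c = 2 * n - 1], and the one around
       [s2 n] to [c = 2 * n]. *)
    apply: (@Phi4_eq R p.*2.+1 (p * p + p.+1 * p.+1)) => //.
    * have -> : (p.*2.+1 * p.*2.+1 + 1)%N = (p * p + p.+1 * p.+1).*2 by nia.
      by rewrite doubleK.
    * by rewrite /= odd_double /=; lia.
    * by rewrite /= odd_double /=; lia.
  + have {}lo : (2 * (2 * (p.+1 * p.+1)) <= 2 * k + p.+1)%N.
      by rewrite -(ler_nat rat) !(natrD, natrM) -!natr1; nra.
    have {}hi : (2 * k <= 2 * (2 * (p.+1 * p.+1)) + p.+1)%N.
      by rewrite -(ler_nat rat) !(natrD, natrM) -!natr1; nra.
    apply: (@Phi4_eq R p.+1.*2 (2 * (p.+1 * p.+1))) => //.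
    * have -> : (p.+1.*2 * p.+1.*2 + 1)%N = (2 * (p.+1 * p.+1)).*2.+1 by nia.
      by rewrite /= uphalf_double.
    * by rewrite odd_double; lia.
    * by rewrite odd_double; lia.
- move=> k [k2 [[//|p] _]]; rewrite /s1 /s3.
  have -> : p.+1%:R = p%:R + 1 :> rat by rewrite natr1.
  case=> /andP[lo hi].
  + have {}lo : ((p + 1) * (2 * p + 1) <= k)%N.
      by rewrite -(ler_nat rat) !(natrD, natrM); nra.
    have {}hi : (2 * k <= 2 * ((p + 1) * (2 * p + 1)) + p)%N.
      by rewrite -(ler_nat rat) !(natrD, natrM); nra.
    (* For [n = 1] this range is [{1}], excluded by [2 <= k]; hence [c = 2 * n - 1] is at least
       [2]. *)
    have p1 : (1 <= p)%N by case: p lo hi => //; lia.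
    by apply: (@Phi4_lt R k (2 * p + 1) ((p + 1) * (2 * p + 1))) => //; lia.
  + have {}lo : ((p + 1) * (2 * p + 3) <= k)%N.
      by rewrite -(ler_nat rat) !(natrD, natrM); nra.
    have {}hi : (2 * k <= 2 * ((p + 1) * (2 * p + 3)) + p + 1)%N.
      by rewrite -(ler_nat rat) !(natrD, natrM); nra.
    by apply: (@Phi4_lt R k (2 * p + 2) ((p + 1) * (2 * p + 3))) => //; lia.
Qed.
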